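(* Let $q$ be a prime power and let $F$ be a field of characteristic $p>0$ not dividing $q$. Let $m=m(p,q)$, and let $H^{n}_{k,i}$ denote the incidence homology over $F$ of the poset of subspaces of $\mathbb{F}_q^{n}$. Suppose that $0\le k\le n$ with $1\le n$ and $0<i<m$. Then $$H^n_{k,i}\;\cong\; H^{n-1}_{k,i+1}\;\oplus\; H^{n-1}_{k-1,i-1}\;\oplus\; H^{n-2}_{k-1,i}\,S_{n-1}$$ as $FG_{n-1}$-modules, where $G_{n-1}=\mathrm{GL}(n-1,q)$.
   Context: For $i\ge 1$ put $[i]_q=1+q+\dots+q^{i-1}$, and let $m=m(p,q):=\min\{i>1 : [i]_q=0 \text{ in } F\}$. For integers $n\ge 0$ and $k$ let $L^n_k$ be the set of $k$-dimensional subspaces of $\mathbb{F}_q^n$ (row vectors) and let $M^n_k=FL^n_k$ be the $F$-vector space with basis $L^n_k$; $M^n_k=0$ if $k<0$ or $k>n$, and also if $n<0$. The incidence map $\partial:M^n_k\to M^n_{k-1}$ is the linear map sending $x\in L^n_k$ to the sum of all $(k-1)$-dimensional subspaces of $x$. One has $\partial^m=0$. The group $G_n=\mathrm{GL}(n,q)$ acts on $M^n_k$ by right multiplication ($G_0$ is trivial), and $\partial$ commutes with this action. For $0\le i\le m$ define the $FG_n$-module $$H^n_{k,i}:=(\ker\partial^i\cap M^n_k)\,/\,\partial^{m-i}(M^n_{k+m-i}).$$ In particular $H^n_{k,0}=0=H^n_{k,m}$. $G_{n-1}$ is regarded as the subgroup of $G_n$ of block matrices $\begin{pmatrix} 1 &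 0 \\ 0 & g' \end{pmatrix}$ with $g'\in \mathrm{GL}(n-1,q)$. For an $FG_{n-2}$-module $M$ (with $n\ge2$), $M S_{n-1}$ denotes the $FG_{n-1}$-module obtained from $M$ as follows: inflate $M$ to the subgroup $A_{n-2}=\left\{\begin{pmatrix} 1 & 0 \\ a & g'' \end{pmatrix}: a\in(\mathbb{F}_q^{n-2})^T,\ g''\in G_{n-2}\right\}$ of $G_{n-1}$ along the projection $\begin{pmatrix} 1 & 0 \\ a & g'' \end{pmatrix}\mapsto g''$, and then induce from $A_{n-2}$ to $G_{n-1}$. (The index is $q^{n-1}-1$, and a Singer cycle $S_{n-1}$ of $G_{n-1}$, a cyclic subgroup of order $q^{n-1}-1$, is a transversal.) For $n=1$ this summand is $0$. *)

(* Defs.v *)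
From HB Require Import structures.
From mathcomp Require Import all_boot all_order all_algebra.
From mathcomp Require Import all_fingroup all_solvable all_field all_character.

Set Implicit Arguments.
Unset Strict Implicit.
Unset Printing Implicit Defensive.

Import Order.TTheory GRing.Theory Num.Theory.
Local Open Scope ring_scope.

Definition qnum (q i : nat) : nat := (\sum_(j < i) q ^ j)%N.

Section QuantumCharacteristic.

Variables (F : fieldType) (p q : nat).
Hypotheses (charF : p \in [pchar F]) (p_ndvd_q : ~~ (p %| q)%N).

Lemma qchar_exists : exists i, (1 < i)%N && ((qnum q i)%:R == 0 :> F).
Proof.
have p_pr : prime p by case/andP: charF.
have qnumE i : (qnum q i)%:R = \sum_(j < i) (q%:R : F) ^+ j.
  by rewrite natr_sum; apply: eq_bigr => j _; rewrite natrX.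
have [q1 | q_neq1] := eqVneq (q%:R : F) 1.
  exists p; rewrite prime_gt1 //= qnumE.
  rewrite (eq_bigr (fun=> 1)) => [|j _]; last by rewrite q1 expr1n.
  by rewrite sumr_const card_ord (pcharf0 charF).
have pred_gt1 : (1 < p.-1)%N.
  case: p p_pr charF p_ndvd_q => [|[|[|[|r]]]] //= _ char2 odd_q.
  case/eqP: q_neq1; rewrite -(odd_double_half q) natrD -mul2n natrM.
  by rewrite (pcharf0 char2) mul0r addr0; move: odd_q; rewrite dvdn2 negbK => ->.
exists p.-1; rewrite pred_gt1 /= qnumE.
have : (q%:R - 1 : F) * \sum_(j < p.-1) q%:R ^+ j == 0.
  rewrite -subrX1 -natrX subr_eq0 -(eqP (_ : 1%:R == 1 :> F)) //.
  have qgt0 : (0 < q)%N by case: (q) p_ndvd_q; rewrite ?dvdn0.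
  rewrite -subr_eq0 -natrB ?expn_gt0 ?qgt0 // -(dvdn_pcharf charF).
  rewrite -eqn_mod_dvd ?expn_gt0 ?qgt0 //.
  rewrite -(totient_prime p_pr); apply/eqP/Euler_exp_totient.
  by rewrite coprime_sym prime_coprime.
by rewrite mulf_eq0 subr_eq0 (negPf q_neq1).
Qed.

Definition qchar : nat := ex_minn qchar_exists.

End QuantumCharacteristic.

(* GL(n, q) for every n >= 0. MathComp's {'GL_n[K]} consists of matrices of   *)
(* size n.-1.+1, so that it is GL(1, q), not the trivial group, for n = 0.    *)
Record GL (K : finFieldType) (n : nat) :=
  MkGL { GLmx :> 'M[K]_n; GLmx_unit : GLmx \in unitmx }.

Section GLGroup.

Variables (K : finFieldType) (n : nat).

HB.instance Definition _ := [isSub for @GLmx K n].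
HB.instance Definition _ := [Finite of GL K n by <:].

Definition GLone : GL K n := MkGL (unitmx1 K n).

Lemma GLmul_unit (g h : GL K n) : (g : 'M_n) *m h \in unitmx.
Proof. by rewrite unitmx_mul !GLmx_unit. Qed.
Definition GLmul (g h : GL K n) : GL K n := MkGL (GLmul_unit g h).

Lemma GLinv_unit (g : GL K n) : invmx g \in unitmx.
Proof. by rewrite unitmx_inv GLmx_unit. Qed.
Definition GLinv (g : GL K n) : GL K n := MkGL (GLinv_unit g).

Lemma GLmulA : associative GLmul.
Proof. by move=> x y z; apply: val_inj; rewrite /= mulmxA. Qed.
Lemma GLmul1 : left_id GLone GLmul.
Proof. by move=> x; apply: val_inj; rewrite /= mul1mx. Qed.
Lemma GLmulV : left_inverse GLone GLinv GLmul.
Proof. by move=> x; apply: val_inj; rewrite /= mulVmx ?GLmx_unit. Qed.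

HB.instance Definition _ := Finite_isGroup.Build (GL K n) GLmulA GLmul1 GLmulV.

Lemma GLmxM (g h : GL K n) : GLmx (g * h)%g = GLmx g *m GLmx h.
Proof. by []. Qed.
Lemma GLmx1 : GLmx (1%g : GL K n) = 1%:M.
Proof. by []. Qed.

End GLGroup.

Section VspaceFinite.

Import VectorInternalTheory.
Variables (K : finFieldType) (vT : vectType K).

HB.instance Definition _ := [Finite of {vspace vT} by <:].

End VspaceFinite.

Section SubspaceModule.

Variables (F : fieldType) (K : finFieldType) (n : nat).

Local Notation V := 'rV[K]_n.
Local Notation L := {vspace V}.
Local Notation N := #|{: L}|.

Definition subspace_act (x : L) (g : GL K n) : L :=
  (linfun (mulmxr (GLmx g)) @: x)%VS.

Lemma subspace_act1 x : subspace_act x 1%g = x.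
Proof.
rewrite /subspace_act -[RHS]lim1g; congr (_ @: _)%VS; apply/lfunP=> v.
by rewrite !lfunE /= mulmx1.
Qed.

Lemma subspace_actM x g h :
  subspace_act x (g * h)%g = subspace_act (subspace_act x g) h.
Proof.
rewrite /subspace_act -limg_comp; congr (_ @: _)%VS; apply/lfunP=> v.
by rewrite !lfunE /= !lfunE /= mulmxA.
Qed.

Lemma subspace_actS g x y :
  (subspace_act x g <= subspace_act y g)%VS = (x <= y)%VS.
Proof.
apply/idP/idP; last exact: limgS.
move/(limgS (linfun (mulmxr (GLmx g^-1%g)))).
by rewrite -!/(subspace_act _ _) -!subspace_actM mulgV !subspace_act1.
Qed.

Lemma dim_subspace_act g x : \dim (subspace_act x g) = \dim x.
Proof.
rewrite limg_dim_eq //; apply/eqP; rewrite -subv0; apply/subvP=> v.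
rewrite memv_cap memv_ker lfunE /= => /andP[_ /eqP vg0].
by rewrite memv0 -[v](mulmxK (GLmx_unit g)) vg0 mul0mx.
Qed.

(* Matrices act on row vectors on the right, so the row of index              *)
(* enum_rank x is the image of the basis vector x.                            *)
Definition subspace_mx (g : GL K n) : 'M[F]_N :=
  \matrix_(i, j) (enum_val j == subspace_act (enum_val i) g)%:R.

Lemma subspace_mx_repr : mx_repr [set: GL K n] subspace_mx.
Proof.
split=> [|g h _ _]; apply/matrixP=> i j; rewrite !mxE.
  by rewrite subspace_act1 (inj_eq enum_val_inj) eq_sym.
rewrite (bigD1 (enum_rank (subspace_act (enum_val i) g))) //= !mxE.
rewrite enum_rankK eqxx mul1r -subspace_actM big1 ?addr0 // => l ne.
rewrite !mxE; case: eqP => [E | _]; last by rewrite mul0r.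
by case/eqP: ne; rewrite -E enum_valK.
Qed.
Definition subspace_repr : mx_representation F [set: GL K n] N :=
  MxRepresentation subspace_mx_repr.

Definition incidence_mx : 'M[F]_N :=
  \matrix_(i, j) ((enum_val j <= enum_val i)%VS
                  && ((\dim (enum_val j)).+1 == \dim (enum_val i)))%:R.

(* Its row space is M^n_k, viewed inside the direct sum of all the M^n_j.     *)
Definition layer_mx (k : int) : 'M[F]_N :=
  diag_mx (\row_i ((\dim (enum_val i))%:Z == k)%:R).

Lemma incidence_centg : centgmx subspace_repr incidence_mx.
Proof.
apply/centgmxP=> g _; apply/matrixP=> i j; rewrite !mxE.
rewrite (bigD1 (enum_rank (subspace_act (enum_val j) g^-1%g))) //=.
rewrite [X in _ + X]big1 ?addr0 => [|l ne]; last first.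
  rewrite !mxE; case: (enum_val j =P _) => [E | _]; last by rewrite mulr0.
  case/eqP: ne; rewrite E -subspace_actM mulgV subspace_act1.
  by rewrite enum_valK.
rewrite (bigD1 (enum_rank (subspace_act (enum_val i) g))) //=.
rewrite [X in _ = _ + X]big1 ?addr0 => [|l ne]; last first.
  rewrite !mxE; case: (enum_val l =P _) => [E | _]; last by rewrite mul0r.
  by case/eqP: ne; rewrite -E enum_valK.
rewrite !mxE !enum_rankK eqxx mul1r -subspace_actM mulVg subspace_act1 eqxx.
rewrite mulr1 -(subspace_actS g) -subspace_actM mulVg subspace_act1.
by rewrite !dim_subspace_act.
Qed.

Lemma layer_centg k : centgmx subspace_repr (layer_mx k).
Proof.
apply/centgmxP=> g _; rewrite mul_diag_mx mul_mx_diag.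
apply/matrixP=> i j; rewrite !mxE.
case: (enum_val j =P _) => [-> | _]; last by rewrite mulr0 mul0r.
by rewrite dim_subspace_act mulr1 mul1r.
Qed.

Lemma incidence_exp_centg i : centgmx subspace_repr (incidence_mx ^+ i).
Proof.
apply/centgmxP=> g Gg; have cD := centgmxP incidence_centg g Gg.
elim: i => [|i IHi]; first by rewrite expr0 mulmx1 mul1mx.
by rewrite exprS -[_ * _]/(_ *m _) -mulmxA IHi !mulmxA cD.
Qed.

Definition cycles (k : int) (i : nat) : 'M[F]_N :=
  (kermx (incidence_mx ^+ i) :&: layer_mx k)%MS.

Definition boundaries (m : nat) (k : int) (i : nat) : 'M[F]_N :=
  layer_mx (k + (m - i)%N%:Z) *m incidence_mx ^+ (m - i).

Lemma layer_module k : mxmodule subspace_repr (layer_mx k).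
Proof.
apply/mxmoduleP=> g Gg.
by rewrite (centgmxP (layer_centg k) g Gg) submxMl.
Qed.

Lemma cycles_module k i : mxmodule subspace_repr (cycles k i).
Proof.
exact: capmx_module (kermx_centg_module (incidence_exp_centg i))
                    (layer_module k).
Qed.

Lemma boundaries_module m k i : mxmodule subspace_repr (boundaries m k i).
Proof.
apply/mxmoduleP=> g Gg; rewrite /boundaries -mulmxA.
rewrite (centgmxP (incidence_exp_centg _) g Gg) mulmxA.
by rewrite (centgmxP (layer_centg _) g Gg) -mulmxA submxMl.
Qed.

(* section_repr W U is the image of U in the quotient by W; this is U / W     *)
(* since the m-th power of the incidence map is 0 when m = qchar, so that     *)
(* boundaries are cycles.                                                     *)
Definition homology (m : nat) (k : int) (i : nat) :
    representation F [set: GL K n] :=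
  Representation
    (section_repr (boundaries_module m k i) (cycles_module k i)).

End SubspaceModule.

Section Pullback.

Variables (F : fieldType) (aT rT : finGroupType) (D : {group aT}).
Variable (f : {morphism D >-> rT}).

Lemma pullback_sub : D \subset (f @*^-1 [set: rT])%g.
Proof. by apply/subsetP=> x Dx; rewrite mem_morphpre ?inE. Qed.

(* M along f: restriction if f is injective, inflation if f is surjective.    *)
Definition pullback_repr (M : representation F [set: rT]) :
    representation F D :=
  Representation (subg_repr (morphpre_repr f M) pullback_sub).

End Pullback.

Section Induced.

Variables (F : fieldType) (gT : finGroupType) (A G : {group gT}).
Hypothesis sAG : A \subset G.
Variable M : representation F A.

Local Notation r := #|rcosets A G|.

Definition coset_rep (i : 'I_r) : gT := repr (enum_val i).

Lemma rcoset_coset_rep i : (A :* coset_rep i)%g = enum_val i.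
Proof.
rewrite /coset_rep; have /rcosetsP[x _ ->] := enum_valP i.
by apply/rcoset_eqP; rewrite mem_repr_rcoset.
Qed.

Lemma coset_rep_in i : coset_rep i \in G.
Proof.
have /rcosetsP[x Gx defx] := enum_valP i; rewrite /coset_rep defx.
case/rcosetP: (mem_repr_rcoset A x) => a Aa ->.
by rewrite groupM // (subsetP sAG).
Qed.

Lemma coset_rep_eq i j :
  (coset_rep i * (coset_rep j)^-1 \in A)%g = (i == j).
Proof.
rewrite -mem_rcoset; apply/rcoset_eqP/eqP => [|-> //].
by rewrite !rcoset_coset_rep => /enum_val_inj.
Qed.

Lemma coset_rep_ex x : x \in G -> exists i, (x * (coset_rep i)^-1 \in A)%g.
Proof.
move=> Gx; have Ax : (A :* x)%g \in rcosets A G by apply/rcosetsP; exists x.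
exists (enum_rank_in Ax (A :* x)%g).
by rewrite -mem_rcoset rcoset_coset_rep enum_rankK_in ?rcoset_refl.
Qed.

(* On the sum of the M (x) t_i, for representatives t_i of the right cosets   *)
(* of A in G: (v (x) t_i) g = (v a) (x) t_j where t_i g = a t_j with a in A.  *)
Definition induced_mx (g : gT) : 'M[F]_(\sum_(i < r) rdegree M) :=
  \mxblock_(i < r, j < r)
    let a := (coset_rep i * g * (coset_rep j)^-1)%g in
    if a \in A then M a else 0.

Lemma induced_mx_repr : mx_repr G induced_mx.
Proof.
split=> [|g h Gg Gh].
  rewrite -mxdiagZ; apply: eq_mxblock => i j /=.
  rewrite mulg1 coset_rep_eq; case: eqP => [-> | //].
  by rewrite mulgV repr_mx1 conform_mx_id.
rewrite mul_mxblock; apply: eq_mxblock => i l /=.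
have [j Aj] := coset_rep_ex (groupM (coset_rep_in i) Gg).
rewrite (bigD1 j) //= Aj big1 ?addr0 => [|j' ne_j'j]; last first.
  case: ifP => [Aj' | _]; last by rewrite mul0mx.
  case/eqP: ne_j'j; apply/eqP; rewrite -coset_rep_eq.
  by have := groupM (groupVr Aj') Aj; rewrite !invMg invgK !mulgA !mulgKV.
have -> : (coset_rep i * (g * h) * (coset_rep l)^-1
  = (coset_rep i * g * (coset_rep j)^-1)
    * (coset_rep j * h * (coset_rep l)^-1))%g by rewrite !mulgA mulgKV.
rewrite groupMl //; case: ifP => [Al | _]; last by rewrite mulmx0.
by rewrite repr_mxM.
Qed.

Definition induced_repr : representation F G :=
  Representation (MxRepresentation induced_mx_repr).

End Induced.

Section Branching.

Variables (F : fieldType) (K : finFieldType) (n : nat).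

Lemma corner_unit (g : GL K n) :
  (block_mx 1%:M 0 0 g : 'M[K]_(1 + n)) \in unitmx.
Proof. by rewrite unitmxE det_ublock det1 mul1r -unitmxE GLmx_unit. Qed.

Definition corner (g : GL K n) : GL K n.+1 :=
  @MkGL K n.+1 (block_mx 1%:M 0 0 g : 'M_(1 + n)) (corner_unit g).

Lemma cornerM : {in [set: GL K n] &, {morph corner : g h / (g * h)%g}}.
Proof.
move=> g h _ _; apply: val_inj => /=.
rewrite [RHS](@mulmx_block K 1 n 1 n 1 n).
by rewrite !mulmx0 !mul0mx !addr0 !add0r mulmx1.
Qed.
Canonical corner_morphism := Morphism cornerM.

Definition affine_set : {set GL K n.+1} :=
  [set g | (ulsubmx (GLmx g : 'M_(1 + n)) == 1%:M)
           && (ursubmx (GLmx g : 'M_(1 + n)) == 0)].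

Lemma affineP (g : GL K n.+1) : g \in affine_set ->
  (GLmx g : 'M_(1 + n)) = block_mx 1%:M 0 (dlsubmx (GLmx g : 'M_(1 + n)))
                            (drsubmx (GLmx g : 'M_(1 + n))).
Proof.
by rewrite inE => /andP[/eqP ul /eqP ur]; rewrite -[LHS](@submxK _ 1 n 1 n) ul ur.
Qed.

Lemma affine_group_set : group_set affine_set.
Proof.
apply/group_setP; split=> [|g h Ag Ah].
  rewrite inE; have -> : GLmx (1%g : GL K n.+1) = (1%:M : 'M_(1 + n)) by [].
  by rewrite scalar_mx_block block_mxKul block_mxKur !eqxx.
rewrite inE GLmxM (affineP Ag) (affineP Ah) (@mulmx_block K 1 n 1 n 1 n).
by rewrite block_mxKul block_mxKur !mul0mx !mulmx0 !addr0 mulmx1 !eqxx.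
Qed.
Canonical affine_group := Group affine_group_set.

(* Off affine_set the block need not be invertible and the value is junk.     *)
Definition affine_proj (g : GL K n.+1) : GL K n :=
  insubd (1%g : GL K n) (drsubmx (GLmx g : 'M_(1 + n))).

Lemma affine_projE (g : GL K n.+1) : g \in affine_set ->
  GLmx (affine_proj g) = drsubmx (GLmx g : 'M_(1 + n)).
Proof.
move=> Ag; apply: insubdK; rewrite -topredE /= unitmxE.
have := GLmx_unit g; rewrite unitmxE (affineP Ag).
by rewrite (@det_lblock K 1 n) det1 mul1r block_mxKdr.
Qed.

Lemma affine_projM : {in affine_set &, {morph affine_proj : g h / (g * h)%g}}.
Proof.
move=> g h Ag Ah; apply: val_inj.
change (GLmx (affine_proj (g * h)%g)
        = GLmx (affine_proj g) *m GLmx (affine_proj h)).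
have Agh : (g * h)%g \in affine_set by rewrite (@groupM _ affine_group).
rewrite !affine_projE // GLmxM {1}(affineP Ag) {1}(affineP Ah).
by rewrite (@mulmx_block K 1 n 1 n 1 n) block_mxKdr mulmx0 add0r.
Qed.
Canonical affine_proj_morphism := @Morphism _ _ affine_group _ affine_projM.

Definition corner_res (M : representation F [set: GL K n.+1]) :
    representation F [set: GL K n] :=
  pullback_repr corner_morphism M.

Definition singer (M : representation F [set: GL K n]) :
    representation F [set: GL K n.+1] :=
  induced_repr (subsetT affine_group)
    (pullback_repr affine_proj_morphism M).

End Branching.

(* H^(n-1)_(k,i) induced up along S_n to GL(n, q), and 0 if n = 0.            *)
Definition singer_homology (F : fieldType) (K : finFieldType) (m n : nat)
    (k : int) (i : nat) : representation F [set: GL K n] :=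
  match n with
  | 0%N => @grepr0 F _ [set: GL K 0]
  | n'.+1 => singer (homology F K n' m k i)
  end.

(* Main.v *)
Require Import Defs.
From HB Require Import structures.
From mathcomp Require Import all_boot all_order all_algebra.
From mathcomp Require Import all_fingroup all_solvable all_field all_character.

(** Write [V = <e> + U] with [U] of dimension [n].  Subspaces of [V] containing
    [e] correspond to their images in [U]; the others are graphs
    [{(u f, u) | u in y}] of linear forms on subspaces [y] of [U], and the
    transvections [u |-> u f + u] permute the graphs over [y].  Since [q] is
    invertible in [F], one can decompose along the characters of this group; to
    stay over [F] the characters are replaced by the kernel
    [psi = \delta_1 - \delta_0] on the field with [q] elements, whose transform
    is inverted by the kernel [\delta_1 - 1/q].  The coefficients
    [sum_f psi(u f) w(y, f)], with [u] in [y], together with the values of [w]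
    on the subspaces containing [e], give an isomorphism of [M^(n+1)] with [M^n + M^n + (+)_(u != 0) M(U / u)].
    The terms with [u != 0] form the induced module, on which the incidence map
    is [q] times the induced one; on the remaining pairs [(a, b)] it is
    [(a D, q b D + q^n a)], so its [i]-th power is
    [(a D^i, q^i b D^i + q^n [i]_q a D^(i-1))].  As [[i]_q] is invertible, the
    shear [a + c b D] with [c = q^i / (q^n [i]_q)] splits kernels and images,
    the images because [[i]_q + q^i [m-i]_q = [m]_q = 0]. *)

Set Implicit Arguments.
Unset Strict Implicit.
Unset Printing Implicit Defensive.

Import Order.TTheory GRing.Theory Num.Theory.
Local Open Scope ring_scope.

(** * Subquotients *)

Section Subquotient.

Variables (F : fieldType) (gT : finGroupType) (G : {group gT}).

(* R affords U / (U :&: W), by a map beta that need only be equivariant on U. *)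
Definition subquotient (X : lmodType F) (act : gT -> X -> X)
    (U W : X -> Prop) (R : representation F G) : Prop :=
  exists beta : X -> 'rV[F]_(rdegree R),
    [/\ linear beta,
        forall g x, g \in G -> U x -> beta (act g x) = beta x *m R g,
        forall r, exists2 x, U x & beta x = r
      & forall x, U x -> (beta x = 0 <-> W x)].

(** Both representations are [U] modulo [W]: on [U] the maps [l1] and [l2] vanish at the same
    vectors, so [l2] factors through [l1], and the matrix [B] of the factor map is the
    similarity. *)
Lemma subquotient_rsim (X : lmodType F) (act : gT -> X -> X)
    (U W : X -> Prop) (R1 R2 : representation F G) :
    (forall a x y, U x -> U y -> U (a *: x + y)) ->
    (forall g x, g \in G -> U x -> U (act g x)) ->
  subquotient act U W R1 -> subquotient act U W R2 -> mx_rsim R1 R2.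
Proof.
move=> linU actU [b1 [lin1 act1 surj1 ker1]] [b2 [lin2 act2 surj2 ker2]].
pose l1 : {linear X -> 'rV_(rdegree R1)} :=
  HB.pack b1 (GRing.isLinear.Build _ _ _ _ b1 lin1).
pose l2 : {linear X -> 'rV_(rdegree R2)} :=
  HB.pack b2 (GRing.isLinear.Build _ _ _ _ b2 lin2).
have exs i : exists x, U x /\ l1 x = delta_mx 0 i.
  by have [x Ux bx] := surj1 (delta_mx 0 i); exists x.
have [s sP] := fin_all_exists exs.
pose B := \matrix_i l2 (s i).
have U0 : U 0.
  have [x Ux _] := surj1 0.
  by have := linU (-1) x x Ux Ux; rewrite scaleN1r addNr.
have factor x : U x -> l2 x = l1 x *m B.
  (* [x'] lifts [l1 x] through the chosen preimages [s i]; the difference [x - x'] lies in [W], so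
     [l2] does not see it either. *)
  move=> Ux; pose x' := \sum_i l1 x 0 i *: s i.
  have Ux' : U x'.
    rewrite /x'; elim/big_rec: _ => // i y _ Uy; apply: linU => //.
    by case: (sP i).
  have l1x' : l1 x' = l1 x.
    rewrite linear_sum [RHS]row_sum_delta; apply: eq_bigr => i _.
    by rewrite linearZZ; case: (sP i) => _ ->.
  have l2x' : l2 x' = l1 x *m B.
    rewrite linear_sum mulmx_sum_row; apply: eq_bigr => i _.
    by rewrite linearZZ rowK.
  rewrite -l2x'; apply/eqP; rewrite -subr_eq0 -linearB; apply/eqP.
  have Ud : U (x - x') by rewrite addrC -scaleN1r; apply: linU.
  apply/(ker2 _ Ud)/(ker1 _ Ud); change (l1 (x - x') = 0).
  by rewrite linearB l1x' subrr.
have freeB : row_free B.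
  rewrite -kermx_eq0 -submx0; apply/rV_subP => r.
  move/sub_kermxP; have [x Ux <-] := surj1 r.
  move=> l10; have /(ker2 x Ux)/(ker1 x Ux) -> : b2 x = 0.
    by rewrite -[LHS]/(l2 x) factor.
  exact: sub0mx.
have fullB : row_full B.
  rewrite -sub1mx; apply/rV_subP => r _.
  by have [x Ux <-] := surj2 r; rewrite -[b2 x]/(l2 x) factor ?submxMl.
exists B => // [|g Gg].
  by move/eqP: freeB; move/eqP: fullB => -> ->.
apply/row_matrixP => i; rewrite !row_mul [in RHS]rowK.
have [Usi lsi] := sP i; have b1si : b1 (s i) = delta_mx 0 i by [].
transitivity (l2 (act g (s i))); last exact: act2.
rewrite factor; last exact: actU.
by rewrite -[l1 _]/(b1 (act g (s i))) act1 // b1si -rowE.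
Qed.

(** [Phi] must reach all of [UY] but need not be injective on [UX]: what it kills there lies in [WX]
    by the last condition. *)
Lemma subquotient_transport (X Y : lmodType F) (actX : gT -> X -> X)
    (actY : gT -> Y -> Y) (UX WX : X -> Prop) (UY WY : Y -> Prop)
    (R : representation F G) (Phi : X -> Y) :
    linear Phi ->
    (forall g x, g \in G -> UX x -> Phi (actX g x) = actY g (Phi x)) ->
    (forall x, UX x -> UY (Phi x)) ->
    (forall y, UY y -> exists2 x, UX x & Phi x = y) ->
    (forall x, UX x -> (WY (Phi x) <-> WX x)) ->
  subquotient actY UY WY R -> subquotient actX UX WX R.
Proof.
move=> linP actP UP surjP WP [b [linb actb surjb kerb]].
exists (b \o Phi); split=> [a x y | g x Gg Ux | r | x Ux] /=.
- by rewrite linP linb.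
- by rewrite actP // actb //; apply: UP.
- have [y Uy <-] := surjb r; have [x Ux <-] := surjP y Uy.
  by exists x.
- exact: iff_trans (kerb _ (UP _ Ux)) (WP _ Ux).
Qed.

Lemma subquotient_dadd (X Y : lmodType F) (actX : gT -> X -> X)
    (actY : gT -> Y -> Y) (UX WX : X -> Prop) (UY WY : Y -> Prop)
    (RX RY : representation F G) :
    subquotient actX UX WX RX -> subquotient actY UY WY RY ->
  subquotient (X := (X * Y)%type) (fun g v => (actX g v.1, actY g v.2))
    (fun v => UX v.1 /\ UY v.2) (fun v => WX v.1 /\ WY v.2)
    (dadd_grepr RX RY).
Proof.
move=> [bX [linX eqX surjX kerX]] [bY [linY eqY surjY kerY]].
exists (fun v => row_mx (bX v.1) (bY v.2)).
split=> /= [a u v | g v Gg [UX1 UY2] | r | v [UX1 UY2]].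
- by rewrite linX linY scale_row_mx add_row_mx.
- by rewrite eqX // eqY // mul_row_block !mulmx0 addr0 add0r.
- have [x Ux bx] := surjX (lsubmx r); have [y Uy b_y] := surjY (rsubmx r).
  by exists (x, y) => //=; rewrite bx b_y hsubmxK.
- have [kX kX'] := kerX _ UX1; have [kY kY'] := kerY _ UY2.
  rewrite -[0]row_mx0; split=> [/eq_row_mx[/kX ? /kY] // | [/kX' -> /kY' ->]] //.
Qed.

End Subquotient.

Section SubquotientPullback.

Variables (F : fieldType) (aT rT : finGroupType) (D : {group aT}).
Variable (f : {morphism D >-> rT}).

Lemma subquotient_pullback (X : lmodType F) (act : rT -> X -> X)
    (U W : X -> Prop) (R : representation F [set: rT]) :
    subquotient act U W R ->
  subquotient (fun g => act (f g)) U W (pullback_repr f R).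
Proof.
by move=> [b [linb actb surjb kerb]]; exists b; split=> // g x Dg Ux; rewrite actb.
Qed.

End SubquotientPullback.

Section SubquotientInduced.

Variables (F : fieldType) (gT : finGroupType) (A G : {group gT}).
Hypothesis sAG : A \subset G.

Local Notation r := #|rcosets A G|.
Local Notation t := (@coset_rep gT A G).

(** For [g] in [G] and each [j], exactly one [i] meets the membership condition, so the hypothesis
    determines [actI] while leaving open how it is written. *)
Lemma subquotient_induced (X : lmodType F) (act : gT -> X -> X)
    (actI : gT -> {ffun 'I_r -> X} -> {ffun 'I_r -> X})
    (U W : X -> Prop) (M : representation F A) :
    (forall g v i j, g \in G -> (t i * g * (t j)^-1)%g \in A ->
       actI g v j = act (t i * g * (t j)^-1)%g (v i)) ->
    subquotient act U W M ->
  subquotient actI (fun v => forall i, U (v i)) (fun v => forall i, W (v i))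
    (induced_repr sAG M).
Proof.
move=> actIE [b [linb actb surjb kerb]].
exists (fun v : {ffun 'I_r -> X} => \mxrow_i b (v i)).
split=> /= [a u v | g v Gg Uv | w | v Uv].
- by apply/rowP => j; rewrite !mxE !ffunE linb !mxE.
- rewrite /induced_mx mul_mxrow_mxblock; apply: eq_mxrow => j.
  (* The coset of $t_j g^{-1}$ supplies the only block in column [j] of [induced_mx g] whose
     argument lies in [A]. *)
  have [i Ai] := coset_rep_ex A (groupM (coset_rep_in sAG j) (groupVr Gg)).
  have Aij : (t i * g * (t j)^-1)%g \in A.
    by rewrite -groupV !invMg !invgK mulgA.
  rewrite (bigD1 i) //= Aij big1 ?addr0 => [|i' ne_i'i]; last first.
    case: ifP => [Ai' | _]; last by rewrite mulmx0.
    case/eqP: ne_i'i; apply/eqP; rewrite -coset_rep_eq.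
    have := groupM Ai' (groupVr Aij).
    by rewrite !invMg invgK !mulgA !mulgKV !mulgK.
  by rewrite (actIE g v i j Gg Aij) actb.
- have exs i : exists x, U x /\ b x = submxrow w i.
    by have [x Ux bx] := surjb (submxrow w i); exists x.
  have [s sP] := fin_all_exists exs.
  exists (finfun s) => [i|]; first by rewrite ffunE; case: (sP i).
  apply/mxrowP => i; rewrite mxrowK ffunE; by case: (sP i).
- rewrite -(mxrow0 1); split=> [/eq_mxrowP b0 i | Wv].
    by apply/kerb.
  by apply/eq_mxrowP => i; apply/kerb.
Qed.

End SubquotientInduced.

(** The section is the image [S] of [U] in the quotient by [W]. Since [in_submod] inverts
    [val_submod] only on [S], equivariance and the kernel are controlled only for [w] in [U]. *)
Lemma subquotient_section (F : fieldType) (gT : finGroupType) (G : {group gT})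
    (n : nat) (rG : mx_representation F G n) (W U : 'M[F]_n)
    (modW : mxmodule rG W) (modU : mxmodule rG U) :
  subquotient (X := 'rV[F]_n) (fun g w => w *m rG g)
    (fun w => (w <= U)%MS) (fun w => (w <= W)%MS)
    (Representation (section_repr modW modU)).
Proof.
pose S := <<in_factmod W U>>%MS.
have inS (w : 'rV_n) : (w <= U)%MS -> (in_factmod W w <= S)%MS.
  by move=> Uw; rewrite genmxE in_factmodE (in_factmodE _ U) submxMr.
exists (fun w => in_submod S (in_factmod W w)).
split=> [a u v | g w Gg Uw | r | w Uw].
- by rewrite !linearP.
- rewrite (in_factmodJ modW) //.
  by rewrite -in_submodJ ?inS.
- have: (val_submod (U := S) r <= in_factmod W U)%MS.
    by have := val_submodP (U := S) r; rewrite /S genmxE.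
  case/submxP=> y def_r.
  exists (y *m U); first exact: submxMl.
  have -> : in_factmod W (y *m U) = val_submod (U := S) r.
    by rewrite def_r in_factmodE -mulmxA -in_factmodE.
  exact: val_submodK.
- rewrite -in_factmod_eq0; split=> [b0 | /eqP->]; last by rewrite linear0.
  by rewrite -(in_submodK (inS w Uw)) b0 linear0.
Qed.

Lemma eqz_succ (d : nat) (k : int) : (d.+1%:Z == k) = (d%:Z == k - 1).
Proof. by rewrite -addn1 PoszD -[RHS]subr_eq opprK. Qed.

(** * Chains *)

Section Chains.

Variables (F : fieldType) (K : finFieldType).

Local Notation L n := {vspace 'rV[K]_n}.
Local Notation chain n := 'rV[F]_#|{: L n}|.
Local Notation D n := (incidence_mx F K n).

Definition coeff n (w : chain n) (x : L n) : F := w 0 (enum_rank x).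
Definition chain_of n (h : L n -> F) : chain n := \row_j h (enum_val j).

Lemma chain_ofK n (h : L n -> F) : coeff (chain_of h) =1 h.
Proof. by move=> x; rewrite /coeff mxE enum_rankK. Qed.

Lemma chainP n (u v : chain n) : coeff u =1 coeff v <-> u = v.
Proof.
split=> [uv | -> //]; apply/rowP => j.
by have := uv (enum_val j); rewrite /coeff enum_valK.
Qed.

Lemma coeffP n a (u v : chain n) x :
  coeff (a *: u + v) x = a * coeff u x + coeff v x.
Proof. by rewrite /coeff !mxE. Qed.

Lemma coeffZ n a (u : chain n) x : coeff (a *: u) x = a * coeff u x.
Proof. by rewrite /coeff !mxE. Qed.

Lemma coeff0 n x : coeff (0 : chain n) x = 0.
Proof. by rewrite /coeff !mxE. Qed.

Definition covers n (x y : L n) := (x <= y)%VS && ((\dim x).+1 == \dim y).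

Lemma coeff_incidence n (w : chain n) x :
  coeff (w *m D n) x = \sum_(y | covers x y) coeff w y.
Proof.
rewrite /coeff mxE (reindex _ (onW_bij _ (enum_rank_bij _))) /= [RHS]big_mkcond /=.
apply: eq_bigr => y _; rewrite mxE !enum_rankK -/(covers x y).
by case: (covers x y); rewrite ?mulr1 ?mulr0.
Qed.

Lemma coeff_layer n (w : chain n) k x :
  coeff (w *m layer_mx F K n k) x = if (\dim x)%:Z == k then coeff w x else 0.
Proof.
rewrite /coeff mul_mx_diag !mxE enum_rankK.
by case: eqP; rewrite ?mulr1 ?mulr0.
Qed.

Lemma coeff_act n (w : chain n) (g : GL K n) x :
  coeff (w *m subspace_mx F g) x = coeff w (subspace_act x g^-1%g).
Proof.
rewrite /coeff mxE (bigD1 (enum_rank (subspace_act x g^-1%g))) //= mxE !enum_rankK.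
rewrite -subspace_actM mulVg subspace_act1 eqxx mulr1 big1 ?addr0 // => j ne.
rewrite mxE enum_rankK; case: eqP => [E | _]; last by rewrite mulr0.
by case/eqP: ne; rewrite E -subspace_actM mulgV subspace_act1 enum_valK.
Qed.

(** [layer_mx] is a diagonal projection, so $M^n_k$ is its set of fixed chains; in this form
    membership is a rewriting rule. *)
Definition layered n k (w : chain n) := w *m layer_mx F K n k = w.

Lemma layer_mx_layered n k (w : chain n) : layered k (w *m layer_mx F K n k).
Proof.
apply/chainP=> x; rewrite coeff_layer; case: eqP => // nk.
by rewrite coeff_layer (introF eqP nk).
Qed.

Lemma layeredP n k a (u v : chain n) :
  layered k u -> layered k v -> layered k (a *: u + v).
Proof. by move=> lu lv; rewrite /layered mulmxDl -scalemxAl lu lv. Qed.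

Lemma layered_mul n k i (w : chain n) :
  layered (k + i%:Z) w -> layered k (w *m D n ^+ i).
Proof.
elim: i k w => [|i IHi] k w; first by rewrite addr0 expr0 mulmx1.
rewrite intS addrA => /IHi lw; rewrite exprSr -[_ * _]/(_ *m _) mulmxA.
move: (w *m _) lw => v lv; apply/chainP=> x; rewrite coeff_layer.
case: eqP => // ne; rewrite coeff_incidence big1 // => y /andP[_ /eqP dy].
rewrite -lv coeff_layer -dy; case: eqP => // e; case: ne.
by move: e; rewrite -addn1 PoszD => /addIr.
Qed.

Definition is_cycle n k i (w : chain n) := layered k w /\ w *m D n ^+ i = 0.

Definition is_boundary m n k i (w : chain n) :=
  exists2 v, layered (k + (m - i)%N%:Z) v & w = v *m D n ^+ (m - i).

Lemma sub_layer n k (w : chain n) : (w <= layer_mx F K n k)%MS <-> layered k w.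
Proof.
split=> [/submxP[v ->] | <-]; [exact: layer_mx_layered | exact: submxMl].
Qed.

Lemma homology_subquotient m n k i :
  subquotient (X := 'rV[F]_#|{: L n}|) (fun g w => w *m subspace_mx F g)
    (is_cycle k i) (is_boundary m k i) (homology F K n m k i).
Proof.
have := subquotient_section (boundaries_module F K n m k i) (cycles_module F K n k i).
apply: (@subquotient_transport _ _ _ _ _ _ _ _ _ _ _ _ id) => //.
- move=> w [lw Dw0]; rewrite sub_capmx (sub_layer k w).2 // andbT.
  exact/sub_kermxP.
- move=> w; rewrite sub_capmx => /andP[/sub_kermxP Dw0 /sub_layer lw].
  by exists w.
- move=> w _; rewrite /boundaries; split=> [/submxP[v ->] | [v lv ->]].
    exists (v *m layer_mx F K n (k + (m - i)%N)); last by rewrite mulmxA.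
    exact: layer_mx_layered.
  by rewrite -lv -mulmxA submxMl.
Qed.

End Chains.

(** * A Fourier transform without characters *)

Section Fourier.

Variables (F : fieldType) (K : finFieldType).
Local Notation q := (#|K|%:R : F).
Hypothesis q_neq0 : q != 0.

(* phi and psi are dual kernels: they take over the role of an additive        *)
(* character of K and its inverse, whose values need not lie in F.            *)
Definition phi (s : K) : F := (s == 1)%:R - q^-1.
Definition psi (s : K) : F := (s == 1)%:R - (s == 0)%:R.

Lemma sum_indicator (c : K) (h : K -> F) : \sum_s (s == c)%:R * h s = h c.
Proof.
rewrite (bigD1 c) //= eqxx mul1r big1 ?addr0 // => s /negPf->.
by rewrite mul0r.
Qed.

Lemma sum_psi (h : K -> F) : \sum_s psi s * h s = h 1 - h 0.
Proof.
rewrite -(sum_indicator 1 h) -(sum_indicator 0 h) -sumrB.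
by apply: eq_bigr => s _; rewrite mulrBl.
Qed.

Lemma sum_psi0 : \sum_s psi s = 0.
Proof.
rewrite (eq_bigr (fun s => psi s * 1)) => [|s _]; last by rewrite mulr1.
by rewrite (sum_psi (fun=> 1)) subrr.
Qed.

Lemma sum_phi0 : \sum_s phi s = 0.
Proof.
rewrite sumrB sumr_const -[_ *+ #|_|]mulr_natl divff //.
rewrite (eq_bigr (fun s => (s == 1)%:R * 1)) => [|s _]; last by rewrite mulr1.
by rewrite (sum_indicator 1 (fun=> 1)) subrr.
Qed.

Lemma reindex_affine (a x : K) (h : K -> F) :
  a != 0 -> \sum_s h (x + s * a) = \sum_s h s.
Proof.
move=> a_neq0; rewrite [RHS](reindex_inj (h := fun s => x + s * a)) //=.
by move=> s t /addrI/(mulIf a_neq0).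
Qed.

Section LinearForms.

Variables (a b : nat) (Y : {vspace 'M[K]_(a, b)}).
Variables (alpha beta : 'M[K]_(a, b) -> K).
Hypotheses (linA : scalar alpha) (linB : scalar beta).

(** [Y] is stable under translation by each multiple of [v]; averaging over these $q$ translations
    turns a sum over [Y] into sums over [K]. *)
Lemma sum_translate v (G : K -> K -> F) : v \in Y ->
  q * (\sum_(u in Y) G (alpha u) (beta u))
  = \sum_(u in Y) \sum_s G (alpha u + s * alpha v) (beta u + s * beta v).
Proof.
move=> Yv; rewrite exchange_big /= mulr_natl -sumr_const.
apply: eq_bigr => s _; rewrite (reindex_inj (addrI (s *: v))) /=.
apply: eq_big => [u | u _]; first by rewrite rpredDl // memvZ.
by rewrite linA linB [alpha u + _]addrC [beta u + _]addrC.
Qed.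

(** A nonzero form is equidistributed: $s\mapsto\alpha(u)+s\alpha(v)$ permutes [K]. *)
Lemma sum_linear_form v (h : K -> F) : v \in Y -> alpha v != 0 ->
  q * (\sum_(u in Y) h (alpha u)) = #|Y|%:R * \sum_s h s.
Proof.
move=> Yv av; rewrite (sum_translate (fun x _ => h x) Yv) /=.
rewrite (eq_bigr (fun=> \sum_s h s)) => [|u _]; last exact: reindex_affine.
by rewrite sumr_const mulr_natl.
Qed.

(** For equal forms the sum reduces to $\sum_s\psi(s)\phi(s)=\phi(1)-\phi(0)=1$, or to
    $\psi(0)\phi(0)=q^{-1}$ if both are zero on [Y]. Distinct forms either have different kernels,
    and one of $\sum\phi=0$, $\sum\psi=0$ applies, or are proportional with a ratio other than 0 and
    1. *)
Lemma fourier_inversion :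
  q * (\sum_(u in Y) phi (alpha u) * psi (beta u))
  = if [forall u in Y, alpha u == beta u] then #|Y|%:R else 0.
Proof.
case: ifPn => [/forall_inP eqAB | neqAB].
  rewrite (eq_bigr (fun u => psi (alpha u) * phi (alpha u))) => [|u Yu]; last first.
    by rewrite mulrC (eqP (eqAB u Yu)).
  case: (pickP (fun u => (u \in Y) && (alpha u != 0))) => [v /andP[Yv av] | A0].
    rewrite (sum_linear_form (fun s => psi s * phi s) Yv av) sum_psi /phi.
    by rewrite eqxx eq_sym oner_eq0 opprB addrA subrK subr0 mulr1.
  rewrite (eq_bigr (fun=> q^-1)) => [|u Yu]; last first.
    have := A0 u; rewrite Yu /= => /negbFE/eqP->.
    by rewrite /psi /phi eqxx eq_sym oner_eq0 !sub0r mulrNN mul1r.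
  by rewrite sumr_const mulrnAr divff.
(* Translating by a vector where exactly one form vanishes moves only the argument of the other one,
   whose kernel function sums to 0 over [K]. *)
case: (pickP (fun u => [&& u \in Y, alpha u == 0 & beta u != 0]))
  => [v /and3P[Yv /eqP av bv] | AB].
  rewrite (sum_translate (fun x y => phi x * psi y) Yv) big1 // => u _.
  rewrite av (eq_bigr (fun s => phi (alpha u) * psi (beta u + s * beta v))) => [|s _].
    by rewrite -mulr_sumr reindex_affine // sum_psi0 mulr0.
  by rewrite mulr0 addr0.
case: (pickP (fun u => [&& u \in Y, beta u == 0 & alpha u != 0]))
  => [v /and3P[Yv /eqP bv av] | BA].
  rewrite (sum_translate (fun x y => phi x * psi y) Yv) big1 // => u _.
  rewrite bv (eq_bigr (fun s => phi (alpha u + s * alpha v) * psi (beta u))) => [|s _].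
    by rewrite -mulr_suml reindex_affine // sum_phi0 mul0r.
  by rewrite mulr0 addr0.
have [v Yv neq_v] : exists2 v, v \in Y & alpha v != beta v.
  by move: neqAB; rewrite negb_forall_in => /exists_inP.
have av : alpha v != 0.
  apply: contra neq_v => av; have := AB v; rewrite Yv av /= => /negbFE/eqP->.
  exact: av.
have bv : beta v != 0.
  apply: contra neq_v => bv; have := BA v.
  by rewrite Yv bv /= => /negbFE/eqP->; rewrite eq_sym.
pose l := beta v / alpha v.
have betaE u : u \in Y -> beta u = alpha u * l.
  (* This combination of [u] and [v] is killed by [alpha], hence by [beta]. *)
  move=> Yu; have := AB (- (alpha u / alpha v) *: v + u).
  rewrite linA linB memvD ?memvZ //= mulNr divfK // addNr eqxx /=.
  by move=> /negbFE; rewrite addrC mulNr subr_eq0 => /eqP->; rewrite mulrAC -mulrA.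
rewrite (eq_bigr (fun u => phi (alpha u) * psi (alpha u * l))); last first.
  by move=> u Yu; rewrite betaE.
rewrite (sum_linear_form (fun s => phi s * psi (s * l)) Yv av).
have l0 : l != 0 by rewrite mulf_neq0 ?invr_eq0.
have l1 : l != 1.
  by apply: contra neq_v => /eqP l1; rewrite -[beta v](divfK av) -/l l1 mul1r.
(* After replacing $s$ by $s/l$ the sum is $\phi(1/l)-\phi(0)$; as $l\neq1$, both values are
   $-q^{-1}$. *)
rewrite (reindex_inj (mulIf (invr_neq0 l0))) /=.
rewrite (eq_bigr (fun s => psi s * phi (s / l))) => [|s _]; last by rewrite mulrC divfK.
rewrite (sum_psi (fun s => phi (s / l))) /phi mul1r mul0r invr_eq1 (negPf l1).
by rewrite eq_sym oner_eq0 subrr mulr0.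
Qed.

End LinearForms.

End Fourier.

(** * Cones and graphs *)

Section ConesAndGraphs.

Variables (K : finFieldType).
Local Notation L n := {vspace 'rV[K]_n}.

Definition apex n : 'rV[K]_n.+1 := row_mx (1 : 'M_1) (0 : 'rV_n).

Definition tail n (v : 'rV[K]_n.+1) : 'rV[K]_n := rsubmx (v : 'rV_(1 + n)).
Lemma tail_linear n : linear (@tail n).
Proof. by move=> a u v; apply: linearP. Qed.
HB.instance Definition _ n :=
  GRing.isLinear.Build K 'rV[K]_n.+1 'rV[K]_n _ (@tail n) (@tail_linear n).

Definition raise n (f : 'cV[K]_n) (u : 'rV[K]_n) : 'rV[K]_n.+1 :=
  row_mx (u *m f) u.
Lemma raise_linear n (f : 'cV[K]_n) : linear (raise f).
Proof.
move=> a u v; rewrite /raise mulmxDl -scalemxAl -add_row_mx -scale_row_mx.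
by [].
Qed.
HB.instance Definition _ n f :=
  GRing.isLinear.Build K 'rV[K]_n 'rV[K]_n.+1 _ (raise f) (@raise_linear n f).

(* The subspaces containing apex are the cones, the others are the graphs;    *)
(* graph y f depends on f only up to ann y.                                   *)
Definition cone n (z : L n) : L n.+1 := (linfun (@tail n) @^-1: z)%VS.
Definition base n (x : L n.+1) : L n := (linfun (@tail n) @: x)%VS.
Definition graph n (y : L n) (f : 'cV[K]_n) : L n.+1 := (linfun (raise f) @: y)%VS.
Definition ann n (y : L n) : {vspace 'cV[K]_n} :=
  lker (linfun (mulmx (lin1_mx (projv y)))).

Lemma tail_row_mx n (a : 'M[K]_1) (u : 'rV[K]_n) : tail (row_mx a u) = u.
Proof. exact: row_mxKr. Qed.

Lemma raiseK n (f : 'cV[K]_n) : cancel (raise f) (@tail n).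
Proof. by move=> u; rewrite /raise tail_row_mx. Qed.

Lemma tail_apex n : tail (apex n) = 0.
Proof. exact: tail_row_mx. Qed.

Lemma mem_cone n (z : L n) v : (v \in cone z) = (tail v \in z).
Proof. by rewrite -memv_preim lfunE. Qed.

Lemma mem_base n (x : L n.+1) v : v \in x -> tail v \in base x.
Proof. by move=> xv; rewrite -[tail v](lfunE (@tail n)) memv_img. Qed.

Lemma baseP n (x : L n.+1) u : reflect (exists2 v, v \in x & u = tail v) (u \in base x).
Proof.
by apply: (iffP memv_imgP) => [] [v xv ->]; exists v; rewrite // lfunE.
Qed.

Lemma graphP n (y : L n) f v :
  reflect (exists2 u, u \in y & v = raise f u) (v \in graph y f).
Proof.
by apply: (iffP memv_imgP) => [] [u yu ->]; exists u; rewrite // lfunE.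
Qed.

Lemma mem_graph n (y : L n) f u : (raise f u \in graph y f) = (u \in y).
Proof.
apply/graphP/idP => [[w yw /(congr1 (@tail n))] | yu]; last by exists u.
by rewrite !raiseK => ->.
Qed.

Lemma apex_cone n (z : L n) : apex n \in cone z.
Proof. by rewrite mem_cone tail_apex mem0v. Qed.

Lemma apex_neq0 n : apex n != 0.
Proof.
apply/eqP=> /(congr1 (fun v : 'rV_(1 + n) => lsubmx v 0 0)).
by rewrite /apex row_mxKl !mxE => /eqP; rewrite oner_eq0.
Qed.

Lemma apex_notin_graph n (y : L n) f : apex n \notin graph y f.
Proof.
apply/graphP=> [[u _ e]]; case/eqP: (apex_neq0 n).
by rewrite e -[u](raiseK f) -e tail_apex linear0.
Qed.

Lemma tail_eq0 n (v : 'rV[K]_n.+1) :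
  tail v = 0 -> v = lsubmx (v : 'rV_(1 + n)) 0 0 *: apex n.
Proof.
move=> v0; rewrite -[LHS](@hsubmxK _ 1 1 n) -[rsubmx _]/(tail v) v0.
rewrite {1}[lsubmx _]mx11_scalar -scalemx1.
by rewrite -[X in row_mx _ X](scaler0 _ (lsubmx (v : 'rV_(1 + n)) 0 0)) -scale_row_mx.
Qed.

Lemma base_cone n (z : L n) : base (cone z) = z.
Proof.
apply/vspaceP=> u; apply/baseP/idP => [[v zv ->] | zu]; first by rewrite -mem_cone.
by exists (raise 0 u); rewrite ?mem_cone raiseK.
Qed.

Lemma base_graph n (y : L n) f : base (graph y f) = y.
Proof.
apply/vspaceP=> u; apply/baseP/idP => [[_ /graphP[w yw ->] ->] | zu].
  by rewrite raiseK.
by exists (raise f u); rewrite ?mem_graph ?raiseK.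
Qed.

Lemma cone_base n (x : L n.+1) : apex n \in x -> cone (base x) = x.
Proof.
move=> xe; apply/vspaceP=> v; rewrite mem_cone.
apply/baseP/idP => [[w xw e]|]; last by exists v.
have -> : v = (v - w) + w by rewrite subrK.
rewrite memvD // [v - w]tail_eq0 ?memvZ //.
by rewrite linearB /= e subrr.
Qed.

Lemma cone_inj n : injective (@cone n).
Proof. exact: can_inj (@base_cone n). Qed.

Lemma coneS n (y z : L n) : (cone y <= cone z)%VS = (y <= z)%VS.
Proof.
apply/idP/idP => [|/lpreimS//]; last exact.
by move=> /(limgS (linfun (@tail n))); rewrite -![(_ @: _)%VS]/(base _) !base_cone.
Qed.

Lemma dim_cone n (z : L n) : \dim (cone z) = (\dim z).+1.
Proof.
have := limg_ker_dim (linfun (@tail n)) (cone z).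
rewrite -[(_ @: _)%VS]/(base _) base_cone.
suff -> : (cone z :&: lker (linfun (@tail n)))%VS = <[apex n]>%VS.
  by rewrite dim_vline apex_neq0.
apply/vspaceP=> v; rewrite memv_cap memv_ker lfunE /= mem_cone.
apply/andP/vlineP => [[_ /eqP/tail_eq0 ->] | [k ->]]; first by eexists.
by rewrite linearZ /= tail_apex scaler0 mem0v.
Qed.

Lemma dim_graph n (y : L n) f : \dim (graph y f) = \dim y.
Proof.
rewrite limg_dim_eq //; apply/eqP; rewrite -subv0; apply/subvP=> v.
rewrite memv_cap memv_ker lfunE /= => /andP[_ /eqP v0].
by rewrite memv0 -(raiseK f v) v0 linear0.
Qed.

(** The kernel of [tail] is the line of the apex, so [tail] is injective on [x]; the form is the
    first coordinate of the inverse map. *)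
Lemma graph_base n (x : L n.+1) :
  apex n \notin x -> exists f, x = graph (base x) f.
Proof.
(* Precomposing with [projv x] restricts [tail] to [x]; the outer [projv x] in [s] puts the chosen
   preimage into [x] without changing its tail. *)
move=> xe; pose h := (linfun (@tail n) \o projv x)%VF.
pose s := (projv x \o h^-1)%VF.
have sx u : s u \in x by rewrite comp_lfunE memv_proj.
have hE v : h v = tail (projv x v) by rewrite comp_lfunE lfunE.
have ds u : u \in base x -> tail (s u) = u.
  case/baseP=> v xv ->; rewrite comp_lfunE -hE limg_lfunVK //.
  by rewrite -(projv_id xv) -hE memv_img ?memvf.
pose f : 'cV_n := lin1_mx (fun u => lsubmx (s u : 'rV_(1 + n))).
have fE u : u *m f = lsubmx (s u : 'rV_(1 + n)).
  have lin : linear (fun u => lsubmx (s u : 'rV_(1 + n))).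
    by move=> a v w; rewrite linearP; apply: linearP.
  pose l : {linear 'rV[K]_n -> 'M[K]_1} :=
    HB.pack (fun u => lsubmx (s u : 'rV_(1 + n)))
            (GRing.isLinear.Build _ _ _ _ _ lin).
  exact: (mul_rV_lin1 l).
have inx u : u \in base x -> raise f u \in x.
  move=> xu; have -> : raise f u = s u; last exact: sx.
  by rewrite /raise fE -[in RHS](@hsubmxK _ 1 1 n (s u)) -[rsubmx _]/(tail (s u)) ds.
exists f; apply/vspaceP=> v; apply/idP/graphP => [xv | [u xu ->]]; last exact: inx.
exists (tail v); first exact: mem_base.
(* This difference is a multiple of the apex and lies in [x], so it must be 0. *)
have x0 : v - raise f (tail v) \in x by rewrite memvB // inx // mem_base.
have /tail_eq0 e : tail (v - raise f (tail v)) = 0 by rewrite linearB /= raiseK subrr.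
move: x0; rewrite e; set c := lsubmx _ _ _ in e *; have [c0 _ | c0] := eqVneq c 0.
  by apply/eqP; rewrite -subr_eq0 e c0 scale0r.
move=> /(memvZ c^-1); rewrite scalerA mulVf // scale1r.
by rewrite (negPf xe).
Qed.

Lemma annP n (y : L n) (f : 'cV[K]_n) :
  reflect (forall u, u \in y -> u *m f = 0) (f \in ann y).
Proof.
rewrite memv_ker lfunE /=; apply: (iffP eqP) => [f0 u yu | f0].
  by rewrite -(projv_id yu) -(mul_rV_lin1 (projv y)) -mulmxA f0 mulmx0.
apply/row_matrixP=> i; rewrite row_mul rowE mul_rV_lin1 row0.
by rewrite f0 // memv_proj.
Qed.

Lemma ann_subP n (y : L n) (f g : 'cV[K]_n) :
  reflect {in y, forall u, u *m f = u *m g} (f - g \in ann y).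
Proof.
apply: (iffP (annP _ _)) => fg u /fg.
  by rewrite mulmxBr => /eqP; rewrite subr_eq0 => /eqP.
by rewrite mulmxBr => ->; rewrite subrr.
Qed.

Lemma graph_eq n (y : L n) f g : (graph y f == graph y g) = (f - g \in ann y).
Proof.
apply/eqP/ann_subP => [e u yu | fg].
  have : raise f u \in graph y g by rewrite -e mem_graph.
  case/graphP=> w _ e'; have /(congr1 (@tail n)) := e'; rewrite !raiseK => uw.
  move: e'; rewrite -uw => /(congr1 (fun v => lsubmx (v : 'rV_(1 + n)))).
  by rewrite !row_mxKl.
by apply/vspaceP=> v; apply/graphP/graphP => [] [u yu ->]; exists u;
   rewrite // /raise fg.
Qed.

(** [P] is the complement of the projection onto [y]: its columns annihilate [y], and one of them is
    nonzero at [v]. *)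
Lemma ann_separate n (y : L n) v : v \notin y ->
  exists2 f : 'cV[K]_n, f \in ann y & (v *m f) 0 0 = 1.
Proof.
move=> yv; pose P := 1%:M - lin1_mx (projv y).
have PE u : u *m P = u - projv y u by rewrite mulmxBr mulmx1 mul_rV_lin1.
have /rV0Pn[j nz] : v *m P != 0.
  rewrite PE subr_eq0; apply: contra yv => /eqP->; exact: memv_proj.
exists (((v *m P) 0 j)^-1 *: col j P).
  apply/annP=> u yu; rewrite -scalemxAr colE mulmxA (PE u) (projv_id yu).
  by rewrite subrr mul0mx scaler0.
by rewrite -scalemxAr colE mulmxA -colE mxE [col _ _ _ _]mxE mulVf.
Qed.

End ConesAndGraphs.

(** * Covers of cones and graphs, and sums over them *)

Section GraphSums.

Variables (F : fieldType) (K : finFieldType).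
Local Notation q := (#|K|%:R : F).
Local Notation L n := {vspace 'rV[K]_n}.

Lemma covers_cone n (y z : L n) : covers (cone y) (cone z) = covers y z.
Proof. by rewrite /covers coneS !dim_cone eqSS. Qed.

Lemma covers_act n (y z : L n) (g : GL K n) :
  covers (subspace_act y g) (subspace_act z g) = covers y z.
Proof. by rewrite /covers subspace_actS !dim_subspace_act. Qed.

Lemma baseS n (x y : L n.+1) : (x <= y)%VS -> (base x <= base y)%VS.
Proof. exact: limgS. Qed.

Lemma covers_graph_cone n (y z : L n) f : covers (graph y f) (cone z) = (z == y).
Proof.
rewrite /covers dim_cone dim_graph eqSS; apply/andP/eqP => [[yz /eqP dyz] | ->].
  apply/esym/eqP; rewrite eqEdim dyz leqnn andbT.
  by rewrite -(base_graph y f) -(base_cone z) baseS.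
split=> //; apply/subvP=> _ /graphP[u yu ->].
by rewrite mem_cone raiseK.
Qed.

Lemma covers_graph n (y z : L n) f g :
  covers (graph y f) (graph z g) = covers y z && (f - g \in ann y).
Proof.
rewrite /covers !dim_graph andbAC; congr (_ && _); apply/idP/andP => [yz | [yz fg]].
  split; first by rewrite -(base_graph y f) -(base_graph z g) baseS.
  apply/ann_subP=> u yu; have := subvP yz (raise f u).
  rewrite mem_graph => /(_ yu)/graphP[w _ e].
  have := congr1 (@tail K n) e; rewrite !raiseK => uw.
  move: e; rewrite -uw => /(congr1 (fun v => lsubmx (v : 'rV_(1 + n)))).
  by rewrite !row_mxKl.
have /eqP -> : graph y f == graph y g by rewrite graph_eq.
by apply/subvP=> _ /graphP[u yu ->]; rewrite mem_graph (subvP yz).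
Qed.

Lemma sum_covers_cone n (z : L n) (h : L n.+1 -> F) :
  \sum_(x | covers (cone z) x) h x = \sum_(y | covers z y) h (cone y).
Proof.
rewrite (reindex_onto (@cone K n) (@base K n)) => [|x /andP[zx _]].
  by apply: eq_bigl => y; rewrite covers_cone base_cone eqxx andbT.
by apply: cone_base; apply: (subvP zx); apply: apex_cone.
Qed.

Lemma sum_covers_act n (z : L n) (g : GL K n) (h : L n -> F) :
  \sum_(x | covers (subspace_act z g) x) h x
  = \sum_(y | covers z y) h (subspace_act y g).
Proof.
rewrite (reindex_onto (fun y => subspace_act y g) (fun y => subspace_act y g^-1%g)).
  apply: eq_bigl => y; rewrite covers_act -subspace_actM mulgV subspace_act1.
  by rewrite eqxx andbT.
by move=> x _; rewrite -subspace_actM mulVg subspace_act1.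
Qed.

Lemma sum_ann_coset n (y : L n) f0 (c : 'cV[K]_n -> F) :
    (forall f g, f - g \in ann y -> c f = c g) ->
  \sum_(f | f - f0 \in ann y) c f = c f0 *+ #|ann y|.
Proof.
move=> inv_c; rewrite (eq_bigr (fun=> c f0)) => [|f]; last exact: inv_c.
rewrite (reindex_inj (addIr f0)) /= -sumr_const.
by apply: eq_bigl => f; rewrite addrK.
Qed.

Lemma ann_antimono n (y z : L n) : (y <= z)%VS -> (ann z <= ann y)%VS.
Proof.
move=> yz; apply/subvP=> f /annP f0; apply/annP=> u yu.
by apply: f0; apply: (subvP yz).
Qed.

(* Evaluation at a vector of z outside y maps ann y onto K with kernel ann z. *)
Lemma card_ann_covers n (y z : L n) : covers y z -> #|ann y| = (#|K| * #|ann z|)%N.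
Proof.
case/andP=> yz /eqP dz.
have [v zv yv] : exists2 v, v \in z & v \notin y.
  by apply/subvPn; apply: contraL (leqnn (\dim z)) => /dimvS; rewrite -dz ltnNge => ->.
have defz : (z = y + <[v]>)%VS.
  apply/esym/eqP; rewrite eqEdim subv_add yz -memvE zv /= -dz.
  have ysub : (y <= y + <[v]>)%VS by apply: addvSl.
  rewrite ltnNge (geq_leqif (dimv_leqif_sup ysub)) subv_add -memvE.
  by rewrite (negPf yv) andbF.
have [f1 yf1 vf1] := ann_separate yv.
pose vl (f : 'cV[K]_n) : K := (v *m f) 0 0.
have vlD f g a : vl (f + a *: g) = vl f + a * vl g.
  by rewrite /vl mulmxDr -scalemxAr !mxE.
rewrite -sum1_card (partition_big vl xpredT) //=.
rewrite (eq_bigr (fun=> #|ann z|)) => [|s _]; first by rewrite sum_nat_const.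
rewrite (reindex_inj (addIr (s *: f1))) /= -sum1_card; apply: eq_bigl => f.
rewrite rpredDr ?memvZ // vlD -/(vl f1) [vl f1]vf1 mulr1 -subr_eq0 addrK.
apply/andP/idP => [[yf /eqP vf] | zf].
  apply/annP=> u; rewrite defz => /memv_addP[u1 yu1 [_ /vlineP[k ->] ->]].
  rewrite mulmxDl -scalemxAl (annP _ _ yf) // add0r.
  by rewrite [v *m f]mx11_scalar -/(vl f) vf -scalemx1 scale0r scaler0.
split; first exact: (subvP (ann_antimono yz)).
by rewrite /vl (annP _ _ zf) // mxE.
Qed.

(** What covers [graph y f] is [cone y] and the graphs that extend it over a cover [z] of [y]. The
    hypothesis says that [c f] depends only on the restriction of [f] to [y]. *)
Lemma sum_graph_boundary n (y : L n) (c : 'cV[K]_n -> F) (w : L n.+1 -> F) :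
    (forall f g, f - g \in ann y -> c f = c g) ->
  \sum_f c f * (\sum_(x | covers (graph y f) x) w x)
  = (\sum_f c f) * w (cone y)
    + q * \sum_(z | covers y z) \sum_f c f * w (graph z f).
Proof.
move=> inv_c.
have split_sum f : \sum_(x | covers (graph y f) x) w x = w (cone y)
    + \sum_(z | covers y z)
        \sum_(x : L n.+1 | (apex K n \notin x) && (base x == z)
                            && covers (graph y f) x) w x.
  rewrite (bigID (fun x : L n.+1 => apex K n \in x)) /=; congr (_ + _).
    rewrite (big_pred1 (cone y)) // => x; apply/andP/eqP => [[yx xe] | ->].
      by move: yx; rewrite -(cone_base xe) covers_graph_cone => /eqP->.
    by rewrite covers_graph_cone eqxx apex_cone.
  rewrite (partition_big (@base K n) (covers y)) /= => [|x /andP[yx xe]].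
    by apply: eq_bigr => z _; apply: eq_bigl => x; rewrite [RHS]andbC andbA.
  have [g xg] := graph_base xe.
  by move: yx; rewrite xg covers_graph base_graph => /andP[].
under eq_bigr => f _ do rewrite split_sum mulrDr mulr_sumr.
rewrite big_split /= -mulr_suml; congr (_ + _).
rewrite exchange_big mulr_sumr /=; apply: eq_bigr => z yz.
rewrite [in RHS](partition_big (graph z)
  (fun x : L n.+1 => (apex K n \notin x) && (base x == z))) /=; last first.
  by move=> f _; rewrite apex_notin_graph base_graph eqxx.
under eq_bigr => f _ do rewrite mulr_sumr.
rewrite (exchange_big_dep
  (fun x : L n.+1 => (apex K n \notin x) && (base x == z))) /=; last first.
  by move=> f x _ /andP[].
rewrite mulr_sumr; apply: eq_bigr => x /andP[xe /eqP bx].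
have [g] := graph_base xe; rewrite bx => defx.
rewrite (eq_bigl (fun f => f - g \in ann y)); last first.
  by move=> f; rewrite xe eqxx defx covers_graph yz.
(* On the left, [x] occurs for the [#|ann y|] vectors that agree with [g] on [y]; on the right, only
   for the [#|ann z|] that agree on [z]. The ratio is $q$. *)
rewrite -mulr_suml sum_ann_coset //.
rewrite [in RHS](eq_bigl (fun f => f - g \in ann z)); last first.
  by move=> f; rewrite defx graph_eq.
rewrite [in RHS](eq_bigr (fun f => c f * w x)); last first.
  by move=> f; rewrite -graph_eq defx => /eqP->.
rewrite -mulr_suml sum_ann_coset => [|f f' zff']; last first.
  by apply/inv_c/(subvP (ann_antimono _) _ zff'); case/andP: yz.
by rewrite (card_ann_covers yz) mulrnA mulrA mulr_natl mulrnAC.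
Qed.

End GraphSums.

(** * Cone part, graph part and twists of a chain *)

Section Transforms.

Variables (F : fieldType) (K : finFieldType).
Local Notation q := (#|K|%:R : F).
Local Notation L n := {vspace 'rV[K]_n}.
Local Notation chain n := 'rV[F]_#|{: L n}|.
Local Notation D n := (incidence_mx F K n).

Definition pairing n (u : 'rV[K]_n) (f : 'cV[K]_n) : K := (u *m f) 0 0.

Definition cone_part n (w : chain n.+1) : chain n :=
  chain_of (fun z => coeff w (cone z)).
(* The sum runs over column vectors f rather than linear forms on y, so each  *)
(* graph counts #|ann y| times; the same holds for twist.                     *)
Definition graph_part n (w : chain n.+1) : chain n :=
  chain_of (fun y => \sum_f coeff w (graph y f)).
Definition twist n (u : 'rV[K]_n) (y : L n) (w : chain n.+1) : F :=
  \sum_f psi F (pairing u f) * coeff w (graph y f).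

Lemma cone_part_linear n : linear (@cone_part n).
Proof.
by move=> a u v; apply/chainP=> z; rewrite coeffP !chain_ofK coeffP.
Qed.

Lemma graph_part_linear n : linear (@graph_part n).
Proof.
move=> a u v; apply/chainP=> z; rewrite coeffP !chain_ofK mulr_sumr -big_split /=.
by apply: eq_bigr => f _; rewrite coeffP.
Qed.

Lemma twist_linear n (u : 'rV[K]_n) y : scalar (twist u y).
Proof.
move=> a v w; rewrite /twist mulr_sumr -big_split /=.
by apply: eq_bigr => f _; rewrite coeffP mulrDr mulrCA.
Qed.

Lemma pairing_linearl n (f : 'cV[K]_n) : scalar (fun u => pairing u f).
Proof. by move=> a u v; rewrite /pairing mulmxDl -scalemxAl !mxE. Qed.

Lemma pairing_linearr n (u : 'rV[K]_n) : scalar (pairing u).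
Proof. by move=> a f g; rewrite /pairing mulmxDr -scalemxAr !mxE. Qed.

Lemma pairing_ann n (y : L n) u f g :
  u \in y -> f - g \in ann y -> pairing u f = pairing u g.
Proof. by move=> yu /ann_subP fg; rewrite /pairing fg. Qed.

Lemma cone_part_incidence n (w : chain n.+1) :
  cone_part (w *m D n.+1) = cone_part w *m D n.
Proof.
apply/chainP=> z; rewrite chain_ofK !coeff_incidence sum_covers_cone.
by apply: eq_bigr => y _; rewrite chain_ofK.
Qed.

(** This is [sum_graph_boundary] with weight 1; $q^n$ is the number of column vectors. *)
Lemma graph_part_incidence n (w : chain n.+1) :
  graph_part (w *m D n.+1) = q *: (graph_part w *m D n) + q ^+ n *: cone_part w.
Proof.
apply/chainP=> y; rewrite coeffP coeffZ !chain_ofK coeff_incidence addrC.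
rewrite (eq_bigr (fun f => 1 * \sum_(x | covers (graph y f) x) coeff w x)); last first.
  by move=> f _; rewrite mul1r coeff_incidence.
rewrite (@sum_graph_boundary F K n y (fun=> 1) (coeff w)) //.
rewrite sumr_const card_mx muln1 natrX.
congr (_ + _ * _); apply: eq_bigr => z _; rewrite chain_ofK.
by apply: eq_bigr => f _; rewrite mul1r.
Qed.

Lemma sum_psi_pairing n (u : 'rV[K]_n) : q != 0 -> u != 0 ->
  \sum_f psi F (pairing u f) = 0.
Proof.
move=> q_neq0 u_neq0.
have [f _ uf] : exists2 f, f \in ann (0 : L n)%VS & (u *m f) 0 0 = 1.
  by apply: ann_separate; rewrite memv0.
have := @sum_linear_form F K _ _ fullv _ _ (pairing_linearr u)
  (pairing_linearr u) f (@psi F K).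
rewrite memvf /pairing uf oner_neq0 => /(_ isT isT).
rewrite sum_psi0 mulr0 => /eqP; rewrite mulf_eq0 (negPf q_neq0) /= => /eqP s0.
  rewrite -[RHS]s0.
by apply: eq_bigl => g; rewrite memvf.
Qed.

(** The weight depends on [f] only through [y], as [u] lies in [y], and sums to 0, as [u] is
    nonzero; so the cone term disappears. *)
Lemma twist_incidence n (u : 'rV[K]_n) (y : L n) (w : chain n.+1) :
    q != 0 -> u != 0 -> u \in y ->
  twist u y (w *m D n.+1) = q * \sum_(z | covers y z) twist u z w.
Proof.
move=> q_neq0 u_neq0 yu.
rewrite /twist; under eq_bigr => f _ do rewrite coeff_incidence.
rewrite (@sum_graph_boundary F K n y (fun f => psi F (pairing u f)) (coeff w)).
  by rewrite sum_psi_pairing // mul0r add0r.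
by move=> f g fg; rewrite (pairing_ann yu fg).
Qed.

(** Since $\psi(0)=-1$, the graph part is the missing twist at $u=0$ up to sign. *)
Lemma twist0 n y (w : chain n.+1) : twist 0 y w = - coeff (graph_part w) y.
Proof.
rewrite chain_ofK /twist -sumrN; apply: eq_bigr => f _.
by rewrite /pairing mul0mx mxE /psi eq_sym oner_eq0 eqxx sub0r mulN1r.
Qed.

Lemma card_vspace_neq0 a b (V : {vspace 'M[K]_(a, b)}) : q != 0 -> #|V|%:R != 0 :> F.
Proof. by move=> q_neq0; rewrite card_vspace natrX expf_neq0. Qed.

(** Summing the twists against $\phi(uf_0)$ over $u\in y$ isolates, by [fourier_inversion], the
    vectors [f] equal to [f0] on [y]. The factor left is the product of [#|y|] and [#|ann y|], a
    power of $q$ and so invertible in [F]. *)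
Lemma parts_inj n (w : chain n.+1) : q != 0 ->
    cone_part w = 0 -> graph_part w = 0 ->
    (forall (u : 'rV[K]_n) (y : L n), u != 0 -> u \in y -> twist u y w = 0) ->
  w = 0.
Proof.
move=> q_neq0 A0 B0 T0; apply/chainP=> x; rewrite coeff0.
have [xe | xe] := boolP (apex K n \in x).
  by have /chainP/(_ (base x)) := A0; rewrite chain_ofK coeff0 cone_base.
have [f0 ->] := graph_base xe; move: (base x) => y {x xe}.
have T0' u : u \in y -> twist u y w = 0.
  have [-> _ | u0 yu] := eqVneq u 0; last exact: T0.
  by rewrite twist0 B0 coeff0 oppr0.
have : q * (\sum_(u in y) phi F (pairing u f0) * twist u y w) = 0.
  by rewrite big1 ?mulr0 // => u yu; rewrite T0' // mulr0.
under eq_bigr => u _ do rewrite mulr_sumr.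
rewrite exchange_big /= mulr_sumr.
rewrite (eq_bigr (fun f =>
  if f - f0 \in ann y then #|y|%:R * coeff w (graph y f0) else 0)).
  rewrite -big_mkcond sum_ann_coset // => /eqP.
  rewrite -[X in X == 0]mulr_natl !mulf_eq0.
  by rewrite !(negPf (card_vspace_neq0 _ q_neq0)) /= => /eqP.
move=> f _; under eq_bigr => u _ do rewrite mulrA.
rewrite -mulr_suml mulrA fourier_inversion //; last exact: pairing_linearl.
  have -> : [forall u in y, pairing u f0 == pairing u f] = (f - f0 \in ann y).
    apply/forall_inP/ann_subP => [e u yu | e u yu].
      apply/esym; rewrite [LHS]mx11_scalar [RHS]mx11_scalar.
      by congr (_%:M); exact/eqP/e.
    by rewrite /pairing e.
  by rewrite -graph_eq; case: eqP => [-> | _]; rewrite ?mul0r.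
exact: pairing_linearl.
Qed.

(** The preimage is the inverse transform with kernel [phi]. It is checked by [fourier_inversion] on
    the space of column vectors, with the pairings with [u] and [u'] as forms. *)
Lemma parts_surj n (a b : chain n) (t : 'rV[K]_n -> L n -> F) : q != 0 ->
  exists w : chain n.+1,
    [/\ cone_part w = a, graph_part w = b
      & forall (u : 'rV[K]_n) (y : L n),
          u != 0 -> u \in y -> twist u y w = t u y].
Proof.
move=> q_neq0.
pose T (u : 'rV[K]_n) (y : L n) := if u == 0 then - coeff b y else t u y.
(* Only the class of [fx x] modulo [ann] matters, as it is paired with vectors of the base. The
   default 0 arises only for subspaces through the apex, where [w] does not use it. *)
pose fx (x : L n.+1) := odflt 0 [pick f | x == graph (base x) f].
have fxP y f : fx (graph y f) - f \in ann y.
  rewrite -graph_eq /fx base_graph; case: pickP => [g /eqP <- // | /(_ f)].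
  by rewrite eqxx.
(* For [u = u'] the inversion formula gives $q$ times the sum equal to $q^n$; [c] normalises this to
   1. *)
pose c : F := q / q ^+ n.
pose w : chain n.+1 := chain_of (fun x =>
  if apex K n \in x then coeff a (base x)
  else c * \sum_(u in base x) phi F (pairing u (fx x)) * T u (base x)).
have wT (u' : 'rV[K]_n) (y : L n) : u' \in y -> twist u' y w = T u' y.
  move=> yu'; have wg f :
      coeff w (graph y f) = c * \sum_(u in y) phi F (pairing u f) * T u y.
    rewrite chain_ofK (negPf (apex_notin_graph _ _)) base_graph; congr (_ * _).
    by apply: eq_bigr => u yu; rewrite (pairing_ann yu (fxP y f)).
  rewrite /twist; under eq_bigr => f _ do rewrite wg mulrCA mulr_sumr.
  rewrite -mulr_sumr exchange_big /=.
  rewrite (eq_bigr (fun u => (if u == u' then q ^+ n / q else 0) * T u y)).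
    rewrite (bigD1 u') //= eqxx big1 ?addr0 => [|u /andP[_ /negPf->]]; last first.
      exact: mul0r.
    by rewrite mulrA /c mulf_div [q * _]mulrC divff ?mul1r // mulf_neq0 ?expf_neq0.
  move=> u _; under eq_bigr => f _ do rewrite mulrA [psi _ _ * _]mulrC.
  rewrite -mulr_suml; congr (_ * _).
  apply: (mulfI q_neq0); rewrite -[X in X = _]/(q * _).
  have := @fourier_inversion F K q_neq0 _ _ fullv (pairing u) (pairing u')
           (pairing_linearr u) (pairing_linearr u').
  rewrite (eq_bigl xpredT) => [-> | f]; last by rewrite memvf.
  case: ifPn => [/forall_inP e | ne].
    have -> : u = u'.
      apply/rowP=> j; have := e (delta_mx j 0) (memvf _).
      by rewrite /pairing -!colE !mxE => /eqP.
    by rewrite eqxx card_vspacef card_mx muln1 natrX mulrCA divff // mulr1.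
  case: eqP => [uu' | _]; last by rewrite mulr0.
  by case/negP: ne; apply/forall_inP=> f _; rewrite uu'.
exists w; split.
- by apply/chainP=> z; rewrite !chain_ofK apex_cone base_cone.
- by apply/chainP=> y; apply: oppr_inj; rewrite -twist0 wT ?mem0v // /T eqxx.
- by move=> u y /negPf u0 yu; rewrite wT // /T u0.
Qed.

Lemma cone_part_layer n k (w : chain n.+1) :
  cone_part (w *m layer_mx F K n.+1 k) = cone_part w *m layer_mx F K n (k - 1).
Proof.
by apply/chainP=> z; rewrite coeff_layer !chain_ofK coeff_layer dim_cone eqz_succ.
Qed.

Lemma graph_part_layer n k (w : chain n.+1) :
  graph_part (w *m layer_mx F K n.+1 k) = graph_part w *m layer_mx F K n k.
Proof.
apply/chainP=> y; rewrite coeff_layer !chain_ofK.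
under eq_bigr => f _ do rewrite coeff_layer dim_graph.
by case: eqP => // _; rewrite big1.
Qed.

Lemma twist_layer n k u y (w : chain n.+1) :
  twist u y (w *m layer_mx F K n.+1 k) = if (\dim y)%:Z == k then twist u y w else 0.
Proof.
rewrite /twist; under eq_bigr => f _ do rewrite coeff_layer dim_graph.
by case: eqP => // _; rewrite big1 // => f _; rewrite mulr0.
Qed.

Lemma mem_act n (g : GL K n) (x : L n) v :
  reflect (exists2 u, u \in x & v = u *m g) (v \in subspace_act x g).
Proof.
by apply: (iffP memv_imgP) => [] [u xu ->]; exists u; rewrite // lfunE.
Qed.

Lemma mul_corner n (a : 'M[K]_1) (u : 'rV[K]_n) (g : GL K n) :
  (row_mx a u : 'rV_n.+1) *m corner g = row_mx a (u *m g).
Proof.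
transitivity (row_mx a u *m block_mx 1%:M 0 0 (GLmx g)); first by [].
by rewrite mul_row_block !mulmx0 addr0 add0r mulmx1.
Qed.

Lemma act_cone_corner n (z : L n) (g : GL K n) :
  subspace_act (cone z) (corner g) = cone (subspace_act z g).
Proof.
apply/eqP; rewrite eqEdim !(dim_cone, dim_subspace_act) leqnn andbT.
apply/subvP=> _ /mem_act[v zv ->]; rewrite mem_cone.
rewrite mem_cone in zv; rewrite -[v](@hsubmxK _ 1 1 n) mul_corner tail_row_mx.
by apply/mem_act; exists (rsubmx (v : 'rV_(1 + n))).
Qed.

Lemma act_graph_corner n (y : L n) f (g : GL K n) :
  subspace_act (graph y f) (corner g)
  = graph (subspace_act y g) ((g^-1)%g *m f).
Proof.
apply/eqP; rewrite eqEdim !(dim_graph, dim_subspace_act) leqnn andbT.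
apply/subvP=> _ /mem_act[_ /graphP[u yu ->] ->]; rewrite mul_corner.
apply/graphP; exists (u *m g); first by apply/mem_act; exists u.
by rewrite /raise mulmxA (mulmxK (GLmx_unit g)).
Qed.

Lemma cornerV n (g : GL K n) : ((corner g)^-1)%g = corner g^-1%g.
Proof. by rewrite (morphV (corner_morphism K n)) ?inE. Qed.

Lemma cone_part_act n (w : chain n.+1) (g : GL K n) :
  cone_part (w *m subspace_mx F (corner g)) = cone_part w *m subspace_mx F g.
Proof.
by apply/chainP=> z; rewrite coeff_act !chain_ofK coeff_act cornerV act_cone_corner.
Qed.

Lemma twist_act n u y (w : chain n.+1) (g : GL K n) :
  twist u y (w *m subspace_mx F (corner g))
  = twist (u *m (g^-1)%g) (subspace_act y g^-1%g) w.
Proof.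
rewrite /twist [RHS](reindex_inj (can_inj (mulKmx (GLmx_unit g)))) /=.
apply: eq_bigr => f _; rewrite coeff_act cornerV act_graph_corner invgK.
by rewrite /pairing -mulmxA (mulKmx (GLmx_unit g)).
Qed.

Lemma graph_part_act n (w : chain n.+1) (g : GL K n) :
  graph_part (w *m subspace_mx F (corner g)) = graph_part w *m subspace_mx F g.
Proof.
apply/chainP=> y; apply: oppr_inj; rewrite -twist0 twist_act mul0mx twist0.
by rewrite coeff_act.
Qed.

End Transforms.

(** * Splitting the homology *)

Lemma qnumD q i j : qnum q (i + j) = (qnum q i + q ^ i * qnum q j)%N.
Proof.
rewrite /qnum big_split_ord /=; congr (_ + _)%N; rewrite big_distrr /=.
by apply: eq_bigr => l _; rewrite expnD.
Qed.

Lemma qnum1 q : qnum q 1 = 1%N.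
Proof. by rewrite /qnum big_ord1. Qed.

Section Decomposition.

Variables (F : fieldType) (K : finFieldType).
Local Notation q := (#|K|%:R : F).
Local Notation L n := {vspace 'rV[K]_n}.
Local Notation chain n := 'rV[F]_#|{: L n}|.
Local Notation D n := (incidence_mx F K n).
Local Notation Q i := ((qnum #|K| i)%:R : F).

Hypothesis q_neq0 : q != 0.

(* u_ lists the nonzero vectors of U, and C_ j identifies the subspaces of    *)
(* U / u_ j with the subspaces of U through u_ j.  J is empty for n = 0, where *)
(* n' is a dummy.                                                             *)
Variables (n n' : nat) (J : finType).
Variables (u_ : J -> 'rV[K]_n) (C_ : J -> L n' -> L n).
Hypothesis u_neq0 : forall j, u_ j != 0.
Hypothesis u_inj : injective u_.
Hypothesis mem_uC : forall j z, u_ j \in C_ j z.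
Hypothesis C_inj : forall j, injective (C_ j).
Hypothesis dim_C : forall j z, \dim (C_ j z) = (\dim z).+1.
Hypothesis sum_covers_C : forall j z (h : L n -> F),
  \sum_(y | covers (C_ j z) y) h y = \sum_(z' | covers z z') h (C_ j z').
Hypothesis uC_ex : forall u (y : L n), u != 0 -> u \in y ->
  exists j, exists2 z, u = u_ j & y = C_ j z.

Definition twisted_part (w : chain n.+1) : {ffun J -> chain n'} :=
  [ffun j => chain_of (fun z => twist (u_ j) (C_ j z) w)].

Lemma twisted_part_linear : linear twisted_part.
Proof.
move=> a v w; apply/ffunP=> j; rewrite !ffunE; apply/chainP=> z.
by rewrite coeffP !chain_ofK twist_linear.
Qed.

Lemma mul_incidence_exprSr N e (w : chain N) :
  w *m D N ^+ e.+1 = w *m D N ^+ e *m D N.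
Proof. by rewrite exprSr -[_ * D N]/(_ *m D N) mulmxA. Qed.

Lemma mul_incidence_exprS N e (w : chain N) : w *m D N ^+ e.+1 = w *m D N *m D N ^+ e.
Proof. by rewrite exprS -[D N * _]/(D N *m _) mulmxA. Qed.

Lemma cone_part_exp e (w : chain n.+1) :
  cone_part (w *m D n.+1 ^+ e) = cone_part w *m D n ^+ e.
Proof.
elim: e => [|e IHe]; first by rewrite !expr0 !mulmx1.
by rewrite !mul_incidence_exprSr cone_part_incidence IHe.
Qed.

(** The coefficient $x_e$ of the cone term satisfies $x_1=q^n$ and $x_{e+1}=q x_e+q^n$, hence
    $x_e=q^n[e]_q$. *)
Lemma graph_part_exp e (w : chain n.+1) :
  graph_part (w *m D n.+1 ^+ e.+1)
  = q ^+ e.+1 *: (graph_part w *m D n ^+ e.+1)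
    + (q ^+ n * Q e.+1) *: (cone_part w *m D n ^+ e).
Proof.
elim: e => [|e IHe].
  by rewrite !expr1 expr0 mulmx1 graph_part_incidence qnum1 mulr1.
rewrite mul_incidence_exprSr graph_part_incidence IHe cone_part_exp mulmxDl.
rewrite -!scalemxAl -!mul_incidence_exprSr.
rewrite scalerDr !scalerA -exprS -addrA -scalerDl; congr (_ + _ *: _).
by rewrite -[e.+2]add1n qnumD qnum1 expn1 natrD natrM mulrDr mulr1 addrC mulrCA.
Qed.

Lemma twisted_part_exp e (w : chain n.+1) j :
  twisted_part (w *m D n.+1 ^+ e) j = q ^+ e *: (twisted_part w j *m D n' ^+ e).
Proof.
elim: e => [|e IHe]; first by rewrite !expr0 !mulmx1 scale1r.
rewrite !mul_incidence_exprSr exprS -scalerA scalemxAl -IHe; move: (w *m _) => v.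
apply/chainP=> z; rewrite coeffZ coeff_incidence !ffunE chain_ofK.
rewrite twist_incidence // sum_covers_C; congr (_ * _).
by apply: eq_bigr => z' _; rewrite chain_ofK.
Qed.

Lemma parts_eq (v w : chain n.+1) :
    cone_part v = cone_part w -> graph_part v = graph_part w ->
    (forall j, twisted_part v j = twisted_part w j) ->
  v = w.
Proof.
move=> eA eB eT; apply/eqP; rewrite -subr_eq0 addrC -scaleN1r; apply/eqP.
apply: (parts_inj q_neq0) => [||u y u0 yu].
- by rewrite cone_part_linear eA scaleN1r addNr.
- by rewrite graph_part_linear eB scaleN1r addNr.
- have [j [z -> ->]] := uC_ex u0 yu; rewrite twist_linear.
  have /chainP/(_ z) := eT j; rewrite !ffunE !chain_ofK => ->.
  by rewrite mulN1r addNr.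
Qed.

Lemma layered_parts k (w : chain n.+1) : layered k w ->
  [/\ layered (k - 1) (cone_part w), layered k (graph_part w)
    & forall j, layered (k - 1) (twisted_part w j)].
Proof.
move=> lw; split=> [||j]; rewrite /layered.
- by rewrite -cone_part_layer lw.
- by rewrite -graph_part_layer lw.
apply/chainP=> z; rewrite coeff_layer ffunE chain_ofK -[in RHS]lw twist_layer dim_C.
by rewrite eqz_succ.
Qed.

Lemma layered_parts_ex k (a b : chain n) (v : {ffun J -> chain n'}) :
    layered (k - 1) a -> layered k b -> (forall j, layered (k - 1) (v j)) ->
  exists2 w : chain n.+1, layered k w
    & [/\ cone_part w = a, graph_part w = b & twisted_part w = v].
Proof.
move=> la lb lv.
(* By injectivity of [u_] and of each [C_ j] at most one pair is found; the value 0 elsewhere is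
   arbitrary. *)
pose t (u : 'rV[K]_n) (y : L n) :=
  if [pick p : J * L n' | (u_ p.1 == u) && (C_ p.1 p.2 == y)] is Some p
  then coeff (v p.1) p.2 else 0.
have [w [eA eB eT]] := parts_surj a b t q_neq0.
(* Cutting down to layer [k] leaves the parts unchanged, because they already lie in the matching
   layers. *)
exists (w *m layer_mx F K n.+1 k); first exact: layer_mx_layered.
split; first by rewrite cone_part_layer eA.
  by rewrite graph_part_layer eB.
apply/ffunP=> j; rewrite ffunE -lv; apply/chainP=> z.
rewrite coeff_layer chain_ofK twist_layer dim_C eqz_succ.
rewrite eT // /t.
case: pickP => [[j' z'] /= /andP[/eqP/u_inj -> /eqP/C_inj ->] // |].
by move/(_ (j, z)); rewrite /= !eqxx.
Qed.

Lemma layered_incidence N k (w : chain N) : layered k w -> layered (k - 1) (w *m D N).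
Proof. by move=> lw; rewrite -[D N]expr1; apply: layered_mul; rewrite subrK. Qed.

(** * The shear on cycles and boundaries *)

Section Homology.

(* The i of the theorem is i.+1 here, and m - i is r.+1. *)
Variables (i r : nat) (k : int).
Local Notation m := (i.+1 + r.+1)%N.
Hypotheses (Qi_neq0 : Q i.+1 != 0) (Qm_eq0 : Q m = 0).

(** With this value the graph part of $wD^{i+1}$ is $q^n[i+1]_q$ times the sheared part of $w$
    multiplied by $D^i$. *)
Definition shear_coef : F := q ^+ i.+1 / (q ^+ n * Q i.+1).
Local Notation c := shear_coef.

Lemma shear_coef_neq0 : c != 0.
Proof. by rewrite mulf_neq0 ?invr_eq0 ?mulf_neq0 ?expf_neq0. Qed.

Lemma shear_coefP : q ^+ n * Q i.+1 * c = q ^+ i.+1.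
Proof. by rewrite mulrC divfK // mulf_neq0 ?expf_neq0. Qed.

(** Here $[m]_q=0$ enters, as $[i+1]_q+q^{i+1}[r+1]_q=0$; one shear thus serves both cycles and
    boundaries. *)
Lemma shear_coefN : q ^+ n * Q r.+1 = - c^-1.
Proof.
have : Q i.+1 + q ^+ i.+1 * Q r.+1 = 0 by rewrite -Qm_eq0 qnumD natrD natrM natrX.
move/eqP; rewrite addrC addr_eq0 => /eqP e; rewrite /shear_coef invf_div.
apply: (mulfI (expf_neq0 i.+1 q_neq0)); rewrite mulrCA e !mulrN.
by rewrite mulrCA divff ?mulr1 ?expf_neq0.
Qed.

Definition sheared_part (w : chain n.+1) : chain n :=
  cone_part w + c *: (graph_part w *m D n).

Lemma sheared_part_linear : linear sheared_part.
Proof.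
move=> a v w; rewrite /sheared_part cone_part_linear graph_part_linear.
rewrite mulmxDl -scalemxAl !scalerDr !scalerA [c * a]mulrC.
by rewrite addrACA.
Qed.

(** Let $a,b$ be the cone and graph parts. Vanishing of the graph part of $wD^{i+1}$ means
    $aD^i=-c\,bD^{i+1}$, that is, the sheared part is killed by $D^i$. Given this, $aD^{i+1}=0$ is
    equivalent to $bD^{i+2}=0$. *)
Lemma cycle_parts (w : chain n.+1) : layered k w ->
  is_cycle k i.+1 w <->
  [/\ is_cycle k i.+2 (graph_part w), is_cycle (k - 1) i (sheared_part w)
    & forall j, is_cycle (k - 1) i.+1 (twisted_part w j)].
Proof.
move=> lw; have [lA lB lT] := layered_parts lw.
have lS : layered (k - 1) (sheared_part w).
  rewrite /sheared_part [cone_part w + _]addrC.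
  exact: (layeredP c (layered_incidence lB) lA).
have sE : sheared_part w *m D n ^+ i
    = cone_part w *m D n ^+ i + c *: (graph_part w *m D n ^+ i.+1).
  by rewrite mulmxDl -scalemxAl -mul_incidence_exprS.
split=> [[_ w0] | [[_ B0] [_ S0] T0]].
  have A0 : cone_part w *m D n ^+ i.+1 = 0.
    by rewrite -cone_part_exp w0; apply/chainP=> z; rewrite chain_ofK !coeff0.
  have S0 : sheared_part w *m D n ^+ i = 0.
    have : graph_part (w *m D n.+1 ^+ i.+1) = 0.
      rewrite w0; apply/chainP=> z.
      by rewrite chain_ofK coeff0 big1 // => f _; rewrite coeff0.
    rewrite graph_part_exp -shear_coefP -scalerA -scalerDr => /eqP.
    rewrite scaler_eq0 mulf_eq0 (negPf Qi_neq0) expf_eq0 (negPf q_neq0) andbF /=.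
    by rewrite addrC -sE => /eqP.
  split=> [||j]; split=> //.
    have := congr1 (fun v => v *m D n) S0.
    rewrite sE mulmxDl mul0mx -mul_incidence_exprSr A0 add0r.
    rewrite -scalemxAl -mul_incidence_exprSr => /eqP.
    rewrite scaler_eq0 (negPf shear_coef_neq0).
    by move/eqP.
  apply/eqP; have := twisted_part_exp i.+1 w j; rewrite w0 => /esym/eqP.
  have -> : twisted_part (0 : chain n.+1) j = 0.
    apply/chainP=> z; rewrite ffunE chain_ofK /twist coeff0 big1 // => f _.
    by rewrite coeff0 mulr0.
  by rewrite scaler_eq0 expf_eq0 (negPf q_neq0) andbF.
split=> //; apply: parts_eq => [||j].
- rewrite cone_part_exp; move/eqP: S0; rewrite sE addr_eq0 => /eqP A0.
  rewrite mul_incidence_exprSr A0 -scaleNr -scalemxAl -mul_incidence_exprSr B0 scaler0.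
  by apply/chainP=> z; rewrite chain_ofK !coeff0.
- rewrite graph_part_exp -shear_coefP -scalerA -scalerDr addrC -sE S0 scaler0.
  by apply/chainP=> z; rewrite chain_ofK coeff0 big1 // => f _; rewrite coeff0.
- rewrite twisted_part_exp; case: (T0 j) => _ ->; rewrite scaler0.
  apply/chainP=> z; rewrite ffunE chain_ofK /twist coeff0 big1 // => f _.
  by rewrite coeff0 mulr0.
Qed.

(** The coefficient $-c^{-1}$ makes the two terms in $aD^{r+1}$ cancel in the sheared part, so that
    only the graph part of $w$ contributes to it. *)
Lemma parts_of_boundary (w : chain n.+1) :
  graph_part (w *m D n.+1 ^+ r.+1)
    = (q ^+ r.+1 *: (graph_part w *m D n) - c^-1 *: cone_part w) *m D n ^+ r
  /\ sheared_part (w *m D n.+1 ^+ r.+1)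
    = ((c * q ^+ r.+1) *: graph_part w) *m D n ^+ r.+2.
Proof.
have eB : graph_part (w *m D n.+1 ^+ r.+1)
    = (q ^+ r.+1 *: (graph_part w *m D n) - c^-1 *: cone_part w) *m D n ^+ r.
  rewrite graph_part_exp shear_coefN mulmxDl mulNmx -!scalemxAl.
  by rewrite -mul_incidence_exprS scaleNr.
split=> //; rewrite /sheared_part eB cone_part_exp -mulmxA.
rewrite -[D n ^+ r *m D n]/(D n ^+ r * D n) -exprSr mulmxDl mulNmx.
rewrite -!scalemxAl -mul_incidence_exprS.
rewrite scalerDr scalerN !scalerA divff ?shear_coef_neq0 // scale1r.
by rewrite addrCA subrr addr0.
Qed.

Lemma boundary_parts (w : chain n.+1) : layered k w ->
  [/\ is_boundary m k i.+2 (graph_part w), is_boundary m (k - 1) i (sheared_part w)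
    & forall j, is_boundary m (k - 1) i.+1 (twisted_part w j)] <->
  is_boundary m k i.+1 w.
Proof.
have e1 : (m - i.+1 = r.+1)%N by rewrite addKn.
have e2 : (m - i.+2 = r)%N by rewrite -addSnnS addKn.
have e0 : (m - i = r.+2)%N by rewrite addSnnS addKn.
rewrite /is_boundary e0 e1 e2 => lw.
split=> [[[b1 lb1 eB] [a1 la1 eS] eT] | [w0 lw0 ->]].
  have [v1 lv1 ev1] := fin_all_exists2 eT.
  (* [parts_of_boundary] is a triangular system: the sheared equation gives [b0], and then the graph
     equation gives [a0]. *)
  pose b0 := (c * q ^+ r.+1)^-1 *: a1.
  pose a0 := c *: (q ^+ r.+1 *: (b0 *m D n) - b1).
  pose v0 : {ffun J -> chain n'} := [ffun j => (q ^+ r.+1)^-1 *: v1 j].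
  have lb0 : layered (k + r.+1%:Z) b0.
    rewrite /layered -scalemxAl; congr (_ *: _); rewrite -[RHS]la1.
    congr (_ *m layer_mx F K n _).
    by rewrite [r.+2%:Z]intS addrA subrK.
  have la0 : layered (k + r.+1%:Z - 1) a0.
    rewrite /layered -scalemxAl mulmxBl -scalemxAl (layered_incidence lb0).
    by rewrite intS addrA addrAC addrK lb1.
  have lv0 j : layered (k + r.+1%:Z - 1) (v0 j).
    by rewrite /layered ffunE -scalemxAl addrAC lv1.
  have [w0 lw0 [eA0 eB0 eT0]] := layered_parts_ex la0 lb0 lv0.
  have [eB1 eS1] := parts_of_boundary w0.
  have cq : c * q ^+ r.+1 != 0 by rewrite mulf_neq0 ?shear_coef_neq0 ?expf_neq0.
  have eqB : graph_part w = graph_part (w0 *m D n.+1 ^+ r.+1).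
    rewrite eB1 eB0 eA0 eB scalerA mulVf ?shear_coef_neq0 // scale1r opprB.
    by rewrite addrCA subrr addr0.
  have eqS : sheared_part w = sheared_part (w0 *m D n.+1 ^+ r.+1).
    by rewrite eS1 eB0 eS scalerA divff // scale1r.
  exists w0 => //; apply: parts_eq => // [|j].
    by move: eqS; rewrite /sheared_part -eqB => /addIr.
  rewrite twisted_part_exp ev1 eT0 ffunE -scalemxAl scalerA divff ?expf_neq0 //.
  by rewrite scale1r.
have [lA lB lT] := layered_parts lw0; have [eB eS] := parts_of_boundary w0.
have e : k + r.+1%:Z - 1 = k + r%:Z by rewrite intS addrA addrAC addrK.
split=> [||j].
- exists (q ^+ r.+1 *: (graph_part w0 *m D n) - c^-1 *: cone_part w0) => //.
  rewrite -e /layered mulmxBl -!scalemxAl lA.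
  by rewrite (layered_incidence lB).
- exists ((c * q ^+ r.+1) *: graph_part w0) => //.
  by rewrite /layered -scalemxAl [r.+2%:Z]intS addrA subrK lB.
- exists (q ^+ r.+1 *: twisted_part w0 j); last by rewrite twisted_part_exp -scalemxAl.
  by rewrite /layered -scalemxAl addrAC lT.
Qed.

(** The three parts carry cycles onto cycles and detect boundaries; the shear is equivariant because
    [D] commutes with the group. Keeping [actT] and [R] abstract covers both the empty and the
    nonempty family [J]. *)
Lemma branching_subquotient
    (actT : GL K n -> {ffun J -> chain n'} -> {ffun J -> chain n'})
    (R : representation F [set: GL K n]) :
    (forall g w, twisted_part (w *m subspace_mx F (corner g))
                 = actT g (twisted_part w)) ->
    subquotient actT (fun v => forall j, is_cycle (k - 1) i.+1 (v j))
      (fun v => forall j, is_boundary m (k - 1) i.+1 (v j)) R ->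
  subquotient (X := 'rV[F]_#|{: L n.+1}|)
    (fun g w => w *m subspace_mx F (corner g))
    (is_cycle k i.+1) (is_boundary m k i.+1)
    (dadd_grepr (homology F K n m k i.+2)
      (dadd_grepr (homology F K n m (k - 1) i) R)).
Proof.
move=> twist_eq subR.
have := subquotient_dadd (homology_subquotient F K m n k i.+2)
  (subquotient_dadd (homology_subquotient F K m n (k - 1) i) subR).
apply: (@subquotient_transport _ _ _ _ _ _ _ _ _ _ _ _
  (fun w => (graph_part w, (sheared_part w, twisted_part w)))) => /=.
- by move=> a v w; rewrite graph_part_linear sheared_part_linear twisted_part_linear.
- move=> g w _ _; rewrite graph_part_act twist_eq; congr (_, (_, _)).
  rewrite /sheared_part cone_part_act graph_part_act mulmxDl -scalemxAl.
  have := centgmxP (incidence_centg F K n) g (in_setT g) => /= cD.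
  by rewrite -!mulmxA cD.
- by move=> w cw; have [S _] := cycle_parts (proj1 cw); have [] := S cw.
- move=> [b [a v]] /= [cb [ca cv]].
  (* A preimage is found by undoing the shear before inverting the transform. *)
  have la : layered (k - 1) (a - c *: (b *m D n)).
    by rewrite /layered mulmxBl -scalemxAl (layered_incidence (proj1 cb)) (proj1 ca).
  have [w lw [eA eB eT]] := layered_parts_ex la (proj1 cb) (fun j => proj1 (cv j)).
  have eS : sheared_part w = a by rewrite /sheared_part eA eB subrK.
  exists w; last by rewrite eB eS eT.
  by apply/(cycle_parts lw); rewrite eB eS eT.
- move=> w [lw _]; have [S1 S2] := boundary_parts lw; split.
    by case=> ? [? ?]; apply: S1.
  by case/S2.
Qed.

End Homology.

End Decomposition.

(** * The induced summand *)

Section Affine.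

Variables (K : finFieldType) (n : nat).
Local Notation L n := {vspace 'rV[K]_n}.

(** So [affine_set] is the stabiliser of the apex, and its right cosets correspond to the vectors in
    the orbit of the apex. *)
Lemma mem_affine (g : GL K n.+1) :
  (g \in affine_set K n) = (apex K n *m g == apex K n).
Proof.
have e : apex K n *m g = row_mx (ulsubmx (GLmx g : 'M_(1 + n)))
                                (ursubmx (GLmx g : 'M_(1 + n))).
  transitivity (row_mx 1 0 *m (GLmx g : 'M_(1 + n))); first by [].
  rewrite -{1}[GLmx g](@submxK _ 1 n 1 n) mul_row_block.
  by rewrite !mul0mx !addr0 !mul1mx.
rewrite e inE; apply/andP/eqP => [[/eqP-> /eqP->] // | e'].
by have [-> ->] := @eq_row_mx K 1 1 n _ _ 1 0 e'; rewrite !eqxx.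
Qed.

Lemma act_cone_affine (z : L n) (a : GL K n.+1) : a \in affine_set K n ->
  subspace_act (cone z) a = cone (subspace_act z (affine_proj a)).
Proof.
move=> Aa; apply/eqP; rewrite eqEdim !(dim_cone, dim_subspace_act) leqnn andbT.
apply/subvP=> _ /mem_act[v zv ->]; rewrite mem_cone.
rewrite mem_cone in zv; apply/mem_act; exists (tail v) => //.
rewrite affine_projE // (affineP Aa).
transitivity (tail (row_mx (lsubmx (v : 'rV_(1 + n))) (rsubmx (v : 'rV_(1 + n)))
  *m block_mx 1%:M 0 (dlsubmx (GLmx a : 'M_(1 + n)))
                     (drsubmx (GLmx a : 'M_(1 + n))))).
  by rewrite hsubmxK.
by rewrite mul_row_block tail_row_mx mulmx0 add0r block_mxKdr.
Qed.

(** In the rank factorisation of [u] the middle factor is the apex, so a scalar multiple of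
    [row_ebase u] carries the apex to [u]. *)
Lemma apex_transitive (u : 'rV[K]_n.+1) : u != 0 ->
  exists g : GL K n.+1, apex K n *m g = u.
Proof.
move=> u0; have r1 : \rank u = 1%N by rewrite rank_rV u0.
pose c := col_ebase u 0 0.
have c0 : c != 0.
  have := col_ebase_unit u; rewrite unitmxE [col_ebase u]mx11_scalar det_scalar1.
  by rewrite unitfE.
have gU : c *: row_ebase u \in unitmx by rewrite unitmxZ ?unitfE ?row_ebase_unit.
exists (MkGL gU) => /=; rewrite -[RHS]mulmx_ebase r1 [col_ebase u]mx11_scalar.
rewrite mul_scalar_mx -scalemxAr -scalemxAl; congr (_ *: (_ *m _)).
apply/rowP=> j; rewrite /apex !mxE; case: splitP => l /= jl; rewrite !mxE jl //.
by rewrite [l]ord1.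
Qed.

End Affine.

(** * Nonzero vectors as cosets, and the induced action *)

Section SingerFamily.

Variables (F : fieldType) (K : finFieldType) (n : nat).
Hypothesis q_neq0 : #|K|%:R != 0 :> F.
Local Notation L n := {vspace 'rV[K]_n}.
Local Notation chain n := 'rV[F]_#|{: L n}|.
Local Notation J := 'I_#|rcosets (affine_group K n) [set: GL K n.+1]|.
Local Notation t := (@coset_rep _ (affine_group K n) [set: GL K n.+1]).

Definition singer_vec (j : J) : 'rV[K]_n.+1 := apex K n *m t j.
(** The representative [t j] takes the apex to [singer_vec j], so it takes the subspaces through the
    apex to those through [singer_vec j]. *)
Definition singer_cone (j : J) (z : L n) : L n.+1 := subspace_act (cone z) (t j).

Lemma singer_vec_neq0 j : singer_vec j != 0.
Proof.
apply: contra (apex_neq0 K n) => /eqP e.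
by rewrite -[apex K n](mulmxK (GLmx_unit (t j))) -/(singer_vec j) e mul0mx.
Qed.

Lemma singer_vec_inj : injective singer_vec.
Proof.
move=> i j e; apply/eqP; rewrite -coset_rep_eq mem_affine GLmxM mulmxA.
by rewrite -/(singer_vec i) e /singer_vec (mulmxK (GLmx_unit (t j))).
Qed.

Lemma singer_vec_cone j z : singer_vec j \in singer_cone j z.
Proof. by apply/mem_act; exists (apex K n) => //; apply: apex_cone. Qed.

Lemma singer_cone_inj j : injective (singer_cone j).
Proof.
move=> y z e; apply: cone_inj.
have := congr1 (fun x => subspace_act x (t j)^-1%g) e.
by rewrite /singer_cone -!subspace_actM mulgV !subspace_act1.
Qed.

Lemma dim_singer_cone j z : \dim (singer_cone j z) = (\dim z).+1.
Proof. by rewrite dim_subspace_act dim_cone. Qed.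

Lemma sum_covers_singer_cone j z (h : L n.+1 -> F) :
  \sum_(y | covers (singer_cone j z) y) h y
  = \sum_(y | covers z y) h (singer_cone j y).
Proof.
by rewrite sum_covers_act (sum_covers_cone z (fun y => h (subspace_act y (t j)))).
Qed.

Lemma singer_cone_ex u (y : L n.+1) : u != 0 -> u \in y ->
  exists j, exists2 z, u = singer_vec j & y = singer_cone j z.
Proof.
move=> u0 yu; have [g gu] := apex_transitive u0.
have [j Aj] := coset_rep_ex (affine_group K n) (in_setT g).
have ju : u = singer_vec j.
  rewrite /singer_vec -gu -[g](mulgKV (t j)) GLmxM mulmxA.
  by congr (_ *m _); apply/eqP; rewrite -mem_affine.
exists j; exists (base (subspace_act y (t j)^-1%g)) => //.
rewrite /singer_cone cone_base -?subspace_actM ?mulVg ?subspace_act1 //.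
apply/mem_act; exists u => //.
by rewrite ju /singer_vec (mulmxK (GLmx_unit (t j))).
Qed.

(** This copies the blocks of [induced_mx]; for each [j] only one term of the sum has its argument
    in the stabiliser. *)
Definition singer_act (g : GL K n.+1) (v : {ffun J -> chain n}) :
    {ffun J -> chain n} :=
  [ffun j => \sum_i let a := (t i * g * (t j)^-1)%g in
    if a \in affine_set K n then v i *m subspace_mx F (affine_proj a) else 0].

Lemma singer_actE g v i j : (t i * g * (t j)^-1)%g \in affine_set K n ->
  singer_act g v j = v i *m subspace_mx F (affine_proj (t i * g * (t j)^-1)%g).
Proof.
move=> Aij; rewrite ffunE (bigD1 i) //= Aij big1 ?addr0 // => i' ne_i'i.
case: ifP => // Ai'; case/eqP: ne_i'i; apply/eqP; rewrite -coset_rep_eq.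
have := @groupM _ (affine_group K n) _ _ Ai' (@groupVr _ (affine_group K n) _ Aij).
by rewrite !invMg invgK !mulgA !mulgKV !mulgK.
Qed.

(** Write $t_j g^{-1}=a t_i$ with $a$ fixing the apex: the twist at [j] is pulled back to the one at
    [i], and $a$ acts on the quotient by the apex through [affine_proj]. *)
Lemma twisted_part_act g (w : chain n.+2) :
  twisted_part singer_vec singer_cone (w *m subspace_mx F (corner g))
  = singer_act g (twisted_part singer_vec singer_cone w).
Proof.
apply/ffunP=> j.
have [i Ai] := coset_rep_ex (affine_group K n) (in_setT (t j * g^-1)%g).
set a := (t j * g^-1 * (t i)^-1)%g in Ai.
have aV : (t i * g * (t j)^-1 = a^-1)%g by rewrite /a !invMg !invgK mulgA.
have Aij : (t i * g * (t j)^-1)%g \in affine_set K n.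
  by rewrite aV; apply: (@groupVr _ (affine_group K n)).
rewrite (singer_actE _ Aij) !ffunE; apply/chainP=> z.
rewrite coeff_act !chain_ofK twist_act aV.
have defa : (t j * g^-1 = a * t i)%g by rewrite mulgKV.
congr (twist _ _ _).
  rewrite /singer_vec -mulmxA -GLmxM defa GLmxM mulmxA.
  by congr (_ *m _); apply/eqP; rewrite -mem_affine.
rewrite /singer_cone -subspace_actM defa subspace_actM act_cone_affine //.
rewrite -(morphV (affine_proj_morphism K n)) ?invgK //.
exact: (@groupVr _ (affine_group K n)).
Qed.

Lemma singer_subquotient m k i :
  subquotient singer_act (fun v => forall j, is_cycle k i (v j))
    (fun v => forall j, is_boundary m k i (v j)) (singer (homology F K n m k i)).
Proof.
have := subquotient_pullback (affine_proj_morphism K n)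
  (homology_subquotient F K m n k i).
apply: subquotient_induced => g v i' j _ Aij.
exact: singer_actE.
Qed.

End SingerFamily.

(** * Instantiating the decomposition *)

Theorem theorem1 (K : finFieldType) (F : fieldType) (p : nat)
    (charF : p \in [pchar F]) (p_ndvd_q : ~~ (p %| #|K|)%N)
    (n : nat) (k : int) (i : nat)
    (k_bounds : 0 <= k <= n.+1%:Z)
    (i_bounds : (0 < i < qchar charF p_ndvd_q)%N) :
  let m := qchar charF p_ndvd_q in
  mx_rsim (corner_res (homology F K n.+1 m k i))
    (dadd_grepr (homology F K n m k i.+1)
      (dadd_grepr (homology F K n m (k - 1) i.-1)
        (singer_homology F K m n (k - 1) i))).
Proof.
move=> m; have q_neq0 : #|K|%:R != 0 :> F by rewrite -(dvdn_pcharf charF).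
have [Qm_eq0 Qi_neq0] : (qnum #|K| m)%:R = 0 :> F /\ (qnum #|K| i)%:R != 0 :> F.
  rewrite /m /qchar in i_bounds *.
  case: ex_minnP i_bounds => m' /andP[_ /eqP Qm] min_m'.
  case/andP=> i_gt0 lt_im'; split=> //; apply/negP=> Qi0.
  (* Minimality of $m$ speaks only of indices above 1; for $i=1$ one has $[1]_q=1$. *)
  have [i1 | i1] := leqP i 1; last by move: lt_im'; rewrite ltnNge min_m' // i1.
  have i_eq1 : i = 1%N by apply/eqP; rewrite eqn_leq i1.
  by move: Qi0; rewrite i_eq1 qnum1 oner_eq0.
move: i_bounds; rewrite -/m => /andP[]; move: m Qm_eq0 => m.
case: i Qi_neq0 => // i Qi_neq0 Qm_eq0 _ lt_im.
(* Here [i] has been lowered by one, and [i.+1 < m] makes the truncated subtraction exact, with [r]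
   the remaining difference. *)
have defm : m = (i.+1 + (m - i.+2).+1)%N by rewrite subnSK // subnKC // ltnW.
rewrite defm in Qm_eq0 *; move: (m - _.+2)%N Qm_eq0 => r Qm_eq0.
apply: subquotient_rsim (subquotient_pullback (corner_morphism K n)
  (homology_subquotient F K _ n.+1 k i.+1)) _.
- move=> a u v [lu u0] [lv v0]; split; first exact: layeredP.
  by rewrite mulmxDl -scalemxAl u0 v0 scaler0 addr0.
- move=> g v _ [lv v0]; split.
    rewrite /layered -mulmxA -(centgmxP (layer_centg F K n.+1 k)) ?inE //.
    by rewrite mulmxA lv.
  rewrite -mulmxA -(centgmxP (incidence_exp_centg F K n.+1 i.+1)) ?inE //.
  by rewrite mulmxA v0 mul0mx.
case: n k_bounds => [|n] _.
  (* For $U=0$ there are no nonzero vectors: the family is indexed by ['I_0], and the last summand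
     is the zero representation. *)
  pose u0 (j : 'I_0) : 'rV[K]_0 := 0.
  pose C0 (j : 'I_0) (z : {vspace 'rV[K]_0}) : {vspace 'rV[K]_0} := z.
  apply: (@branching_subquotient F K q_neq0 0 0 'I_0 u0 C0 _ _ _ _ _ _ _
    i r k Qi_neq0 Qm_eq0 (fun g v => v)); try by case.
  - by move=> u y; rewrite [u]thinmx0 eqxx.
  - by move=> g w; apply/ffunP; case.
  exists (fun v => 0); split=> [a u v | g v | w | v _].
  - by rewrite scaler0 addr0.
  - by rewrite mul0mx.
  - by exists 0 => [[]//|]; rewrite [w]thinmx0.
  - by split=> // _ [].
apply: (@branching_subquotient F K q_neq0 n.+1 n _ (@singer_vec K n)
  (@singer_cone K n) _ _ _ _ _ _ _ i r k Qi_neq0 Qm_eq0 (@singer_act F K n)).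
- exact: singer_vec_neq0.
- exact: singer_vec_inj.
- exact: singer_vec_cone.
- exact: singer_cone_inj.
- exact: dim_singer_cone.
- exact: sum_covers_singer_cone.
- exact: singer_cone_ex.
- exact: twisted_part_act.
- exact: singer_subquotient.
Qed.
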